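(* Let $d,n\geq1$ be integers. The set $\mathrm{STab}_d(n)$ of standard $d$-tableaux of size $n$ is in bijection with the spectrum ${\rm Spec}_{\rm JM}$ of the Jucys--Murphy elements $t_1,\dots,t_n,J_1,\dots,J_n$ of the Yokonuma--Hecke algebra ${\rm Y}_{d,n}(q)$.
   Context: Let $q$ be an indeterminate. The Yokonuma--Hecke algebra ${\rm Y}_{d,n}(q)$ is the associative unital $\mathbb{C}[q,q^{-1}]$-algebra generated by $g_1,\dots,g_{n-1},t_1,\dots,t_n$ subject to: $g_ig_j=g_jg_i$ for $|i-j|>1$; $g_ig_{i+1}g_i=g_{i+1}g_ig_{i+1}$ for $i=1,\dots,n-2$; $t_it_j=t_jt_i$ for all $i,j$; $t_jg_i=g_it_{s_i(j)}$ for all $i,j$, where $s_i$ is the transposition $(i,i+1)$; $t_j^d=1$ for all $j$; and $g_i^2=1+(q-q^{-1})e_ig_i$ for all $i$, where $e_i=\frac1d\sum_{s=0}^{d-1}t_i^st_{i+1}^{-s}$. Write $\mathbb{C}(q){\rm Y}_{d,n}(q)=\mathbb{C}(q)\otimes_{\mathbb{C}[q,q^{-1}]}{\rm Y}_{d,n}(q)$. The Jucys--Murphy elements are $t_1,\dots,t_n$ together with $J_1:=1$, $J_{i+1}:=g_iJ_ig_i$ for $i=1,\dots,n-1$. Spectrum. Consider representations of $\mathbb{C}(q){\rm Y}_{d,n}(q)$ satisfying: (i) $t_1,\dots,t_n,J_1,\dots,J_n$ are represented by diagonalisable operators; (ii) for every $i=1,\dots,n-1$, the action of the subalgebra of $\mathbb{C}(q){\rm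 Y}_{d,n}(q)$ generated by $t_i,t_{i+1},J_i,J_{i+1},g_i$ is completely reducible. A $2\times n$ array $\Lambda=\begin{pmatrix}\mathsf{a}_1,\dots,\mathsf{a}_n\\ \mathsf{c}_1,\dots,\mathsf{c}_n\end{pmatrix}$ with entries in $\mathbb{C}(q)$ belongs to ${\rm Spec}_{\rm JM}$ if there exist a representation $V_\Lambda$ satisfying (i) and (ii) and a nonzero vector $\mathbf{v}_\Lambda\in V_\Lambda$ with $t_i(\mathbf{v}_\Lambda)=\mathsf{a}_i\mathbf{v}_\Lambda$ and $J_i(\mathbf{v}_\Lambda)=\mathsf{c}_i\mathbf{v}_\Lambda$ for $i=1,\dots,n$. Standard $d$-tableaux. A $d$-partition of $n$ is a $d$-tuple $\boldsymbol{\lambda}=(\boldsymbol{\lambda}^{(1)},\dots,\boldsymbol{\lambda}^{(d)})$ of (possibly empty) partitions of total size $n$. A $d$-node of $\boldsymbol{\lambda}$ is a triple $(x,y,k)$ where $(x,y)$ (row $x$, column $y$) is a node of the Young diagram of $\boldsymbol{\lambda}^{(k)}$. A $d$-tableau of shape $\boldsymbol{\lambda}$ is a bijection between $\{1,\dots,n\}$ and the set of $d$-nodes of $\boldsymbol{\lambda}$; it is standard if its entries increase along every row and down every column of each diagram. $\mathrm{STab}_d(n)$ is the set of all standard $d$-tableaux of size $n$ (of any shape). *)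

(* Defs.v *)
From HB Require Import structures.
From mathcomp Require Import all_boot all_order all_fingroup all_algebra.
From mathcomp Require Import generic_quotient finmap complex.
From mathcomp Require Import boolp classical_sets functions reals.
From mathcomp Require Import monalg.

Set Implicit Arguments.
Unset Strict Implicit.
Unset Printing Implicit Defensive.

Import GRing.Theory.
Local Open Scope classical_set_scope.
Local Open Scope quotient_scope.
Local Open Scope ring_scope.

(* Indices are 0-based throughout: g_1, ..., g_{n-1} are indexed by 'I_n.-1    *)
(* and t_1, ..., t_n, J_1, ..., J_n by 'I_n.                                   *)

Section Relations.
Variables (K : fieldType) (q : K) (d n : nat).

Lemma ord_lo_proof (i : 'I_n.-1) : (i < n)%N.
Proof. exact: leq_trans (ltn_ord i) (leq_pred n). Qed.

Lemma ord_hi_proof (i : 'I_n.-1) : (i.+1 < n)%N.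
Proof. by rewrite -ltn_predRL. Qed.

Definition ord_lo (i : 'I_n.-1) : 'I_n := Ordinal (ord_lo_proof i).
Definition ord_hi (i : 'I_n.-1) : 'I_n := Ordinal (ord_hi_proof i).

Variables (A : lalgType K) (g : 'I_n.-1 -> A) (t : 'I_n -> A).

(* t_{i+1}^{-s} is written t_{i+1}^{d-s}, the two being equal as t_{i+1}^d = 1 *)
Definition yh_e (i : 'I_n.-1) : A :=
  d%:R^-1 *: \sum_(s < d) t (ord_lo i) ^+ s * t (ord_hi i) ^+ (d - s).

(* yh_rel l r: the defining relation l = r, in terms of candidates g and t for *)
(* the generators.                                                             *)
Inductive yh_rel : A -> A -> Prop :=
| yh_rel_far (i j : 'I_n.-1) of (i.+1 < j)%N || (j.+1 < i)%N :
    yh_rel (g i * g j) (g j * g i)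
| yh_rel_braid (i j : 'I_n.-1) of j = i.+1 :> nat :
    yh_rel (g i * g j * g i) (g j * g i * g j)
| yh_rel_tt (i j : 'I_n) :
    yh_rel (t i * t j) (t j * t i)
| yh_rel_tg (i : 'I_n.-1) (j : 'I_n) :
    yh_rel (t j * g i) (g i * t (tperm (ord_lo i) (ord_hi i) j))
| yh_rel_order (j : 'I_n) :
    yh_rel (t j ^+ d) 1
| yh_rel_quad (i : 'I_n.-1) :
    yh_rel (g i ^+ 2) (1 + (q - q^-1) *: (yh_e i * g i)).

(* The relations admit the one-dimensional solution t_j = 1, g_i = q (g_i = 1  *)
(* in the degenerate cases q = 0 or d = 0 in K).                               *)
Definition triv_g : K := if (q == 0) || (d%:R == 0 :> K) then 1 else q.

Lemma yh_rel_triv (f : {rmorphism A -> K}) l r :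
    (forall c x, f (c *: x) = c * f x) ->
    (forall i, f (g i) = triv_g) -> (forall j, f (t j) = 1) ->
  yh_rel l r -> f l = f r.
Proof.
move=> fZ fg ft; case=> {l r} [i j _|i j _|i j|i j|j|i].
- by rewrite !rmorphM mulrC.
- by rewrite !rmorphM /= !fg.
- by rewrite !rmorphM mulrC.
- by rewrite !rmorphM /= !ft mulr1 mul1r.
- by rewrite rmorphXn rmorph1 /= ft expr1n.
rewrite rmorphXn rmorphD rmorph1 fZ rmorphM fZ rmorph_sum /= fg.
rewrite (eq_bigr (fun=> 1)) => [|s _]; last first.
  by rewrite rmorphM !rmorphXn /= !ft !expr1n mulr1.
rewrite sumr_const card_ord /triv_g.
have [->|q0] /= := eqVneq q 0; first by rewrite invr0 subr0 mul0r expr1n addr0.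
have [->|d0] /= := eqVneq (d%:R : K) 0.
  by rewrite mulr0 mul0r mulr0 expr1n addr0.
by rewrite mulVf // mul1r mulrBl mulVf // -expr2 addrC subrK.
Qed.

End Relations.

Section RelationsMorphism.
Variables (K : fieldType) (q : K) (d n : nat) (A B : lalgType K).
Variables (g : 'I_n.-1 -> A) (t : 'I_n -> A) (f : {rmorphism A -> B}).
Hypothesis fZ : forall c x, f (c *: x) = c *: f x.

Lemma yh_e_map i : f (yh_e d t i) = yh_e d (f \o t) i.
Proof.
rewrite /yh_e fZ rmorph_sum; congr (_ *: _); apply: eq_bigr => s _.
by rewrite rmorphM !rmorphXn.
Qed.

Lemma yh_rel_map l r : yh_rel q d g t l r -> yh_rel q d (f \o g) (f \o t) (f l) (f r).
Proof.
case=> {l r} [i j ij|i j ij|i j|i j|j|i].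
- by rewrite !rmorphM; exact: yh_rel_far.
- by rewrite !rmorphM; exact: yh_rel_braid.
- by rewrite !rmorphM; exact: yh_rel_tt.
- by rewrite !rmorphM; exact: yh_rel_tg.
- by rewrite rmorphXn rmorph1; exact: yh_rel_order.
by rewrite rmorphXn rmorphD rmorph1 fZ rmorphM yh_e_map; exact: yh_rel_quad.
Qed.

Lemma yh_rel_lift l' r' : yh_rel q d (f \o g) (f \o t) l' r' ->
  exists l r, [/\ yh_rel q d g t l r, l' = f l & r' = f r].
Proof.
case=> {l' r'} [i j ij|i j ij|i j|i j|j|i].
- by exists (g i * g j), (g j * g i); split; [exact: yh_rel_far|rewrite rmorphM..].
- exists (g i * g j * g i), (g j * g i * g j).
  by split; [exact: yh_rel_braid|rewrite !rmorphM..].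
- by exists (t i * t j), (t j * t i); split; [exact: yh_rel_tt|rewrite rmorphM..].
- exists (t j * g i), (g i * t (tperm (ord_lo i) (ord_hi i) j)).
  by split; [exact: yh_rel_tg|rewrite rmorphM..].
- exists (t j ^+ d), 1.
  by split; [exact: yh_rel_order|rewrite rmorphXn|rewrite rmorph1].
exists (g i ^+ 2), (1 + (q - q^-1) *: (yh_e d t i * g i)).
split; [exact: yh_rel_quad|by rewrite rmorphXn|].
by rewrite rmorphD rmorph1 fZ rmorphM yh_e_map.
Qed.

End RelationsMorphism.

(* The generator x of the free algebra on X, sealed to keep unification fast.  *)
HB.lock Definition free_gen (K : fieldType) (X : choiceType) (x : X) :
  {malg K[{fmonom X}]} := << fmu x >>.

Section YokonumaHecke.
Variables (K : fieldType) (q : K) (d n : nat).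

Local Notation yh_gen := ('I_n.-1 + 'I_n)%type.
Local Notation yh_free := {malg K[{fmonom yh_gen}]}.

Definition free_g (i : 'I_n.-1) : yh_free := free_gen K (inl i).
Definition free_t (j : 'I_n) : yh_free := free_gen K (inr j).

Definition two_sided_ideal (I : set yh_free) : Prop :=
  [/\ I 0, forall x y, I x -> I y -> I (x + y)
    & forall a x b, I x -> I (a * x * b)].

Definition yh_ideal : set yh_free :=
  [set x | forall I : set yh_free, two_sided_ideal I ->
     (forall l r, yh_rel q d free_g free_t l r -> I (l - r)) -> I x].

Lemma yh_ideal0 : yh_ideal 0.
Proof. by move=> I [I0 _ _] _. Qed.

Lemma yh_idealD x y : yh_ideal x -> yh_ideal y -> yh_ideal (x + y).
Proof.
by move=> Ix Iy I hI hr; have [_ hD _] := hI; apply: hD; [exact: Ix|exact: Iy].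
Qed.

Lemma yh_idealM a x b : yh_ideal x -> yh_ideal (a * x * b).
Proof. by move=> Ix I hI hr; have [_ _ hM] := hI; apply: hM; exact: Ix. Qed.

Lemma yh_idealMl a x : yh_ideal x -> yh_ideal (a * x).
Proof. by move/(yh_idealM a 1); rewrite mulr1. Qed.

Lemma yh_idealMr b x : yh_ideal x -> yh_ideal (x * b).
Proof. by move/(yh_idealM 1 b); rewrite mul1r. Qed.

Lemma yh_idealZ (c : K) x : yh_ideal x -> yh_ideal (c *: x).
Proof. by move/(yh_idealMl c%:A); rewrite -scalerAl mul1r. Qed.

Lemma yh_idealN x : yh_ideal x -> yh_ideal (- x).
Proof. by move/(yh_idealMl (-1)); rewrite mulN1r. Qed.

Lemma yh_ideal_rel l r : yh_rel q d free_g free_t l r -> yh_ideal (l - r).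
Proof. by move=> lr I _; apply. Qed.

Lemma free_scalerAr (c : K) (x y : yh_free) : c *: (x * y) = x * (c *: y).
Proof.
rewrite -!mul_malgC mulrA [RHS]mulrA; congr (_ * y).
rewrite (monalgE x) mulr_sumr mulr_suml; apply: eq_bigr => k _.
by rewrite /malgC !malgM_def !fgmulUU mulrC mul1m mulm1.
Qed.

Definition aug_gen (x : yh_gen) : K := if x is inl _ then triv_g q d else 1.
Definition aug_word (w : {fmonom yh_gen}) : K :=
  \prod_(x <- (w : seq yh_gen)) aug_gen x.

Lemma aug_word_mmorphism : mmorphism aug_word.
Proof.
by split=> [x y|]; rewrite /aug_word ?fmM ?fm1 ?big_cat ?big_nil.
Qed.
HB.instance Definition _ :=
  isMultiplicative.Build _ _ aug_word aug_word_mmorphism.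

Definition aug : {rmorphism yh_free -> K} := mmap idfun aug_word.

Lemma aug_free_gen (x : yh_gen) : aug (free_gen K x) = aug_gen x.
Proof. by rewrite free_gen.unlock /= mmapU /= mul1r /aug_word fmU big_seq1. Qed.

Lemma yh_ideal_aug x : yh_ideal x -> aug x = 0.
Proof.
move=> Ix; apply: (Ix [set y | aug y = 0]) => [|l r /(yh_rel_triv (f := aug)) lr].
  split=> [|a b a0 b0|a b c b0] /=; first exact: rmorph0.
    by rewrite rmorphD a0 b0 addr0.
  by rewrite !rmorphM b0 mulr0 mul0r.
by rewrite /= rmorphB lr ?subrr // => *; [exact: mmapZ|exact: aug_free_gen..].
Qed.

Definition yh_eqv (x y : yh_free) : bool := `[< yh_ideal (x - y) >].

Lemma yh_eqv_refl : reflexive yh_eqv.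
Proof. by move=> x; apply/asboolP; rewrite subrr; exact: yh_ideal0. Qed.

Lemma yh_eqv_sym : symmetric yh_eqv.
Proof.
by move=> x y; apply/asboolP/asboolP => /yh_idealN; rewrite opprB.
Qed.

Lemma yh_eqv_trans : transitive yh_eqv.
Proof.
move=> y x z /asboolP xy /asboolP yz; apply/asboolP.
by rewrite -(subrKA y); exact: yh_idealD.
Qed.

Canonical yh_equiv := EquivRel yh_eqv yh_eqv_refl yh_eqv_sym yh_eqv_trans.

(* The K-algebra presented by the generators g, t and the relations yh_rel. As *)
(* presentations are compatible with base change, for K = C(q) this is the     *)
(* tensor product of C(q) with the algebra so presented over C[q, q^-1].       *)
Definition yokonuma_hecke : Type := {eq_quot yh_equiv}.
Local Notation Y := yokonuma_hecke.
HB.instance Definition _ := Choice.on Y.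

Definition yh_pi (x : yh_free) : Y := \pi_({eq_quot yh_equiv}) x.
Definition yh_repr (a : Y) : yh_free := repr (a : {eq_quot yh_equiv}).

Lemma yh_reprK : cancel yh_repr yh_pi. Proof. exact: reprK. Qed.

Lemma yh_piP x y : yh_pi x = yh_pi y <-> yh_ideal (x - y).
Proof. by split=> [/eqquotP/asboolP|?]; last by apply/eqquotP/asboolP. Qed.

Lemma yh_piK x : yh_ideal (yh_repr (yh_pi x) - x).
Proof. by apply/yh_piP; rewrite yh_reprK. Qed.

(* Sealed, so that unification never unfolds products in the free algebra.     *)
Definition yh_add := locked (fun a b : Y => yh_pi (yh_repr a + yh_repr b)).
Definition yh_opp := locked (fun a : Y => yh_pi (- yh_repr a)).
Definition yh_mul := locked (fun a b : Y => yh_pi (yh_repr a * yh_repr b)).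
Definition yh_scale := locked (fun (c : K) (a : Y) => yh_pi (c *: yh_repr a)).

Lemma yh_pi_add x y : yh_add (yh_pi x) (yh_pi y) = yh_pi (x + y).
Proof.
rewrite /yh_add -lock; apply/yh_piP; rewrite opprD addrACA.
by apply: yh_idealD; exact: yh_piK.
Qed.

Lemma yh_pi_opp x : yh_opp (yh_pi x) = yh_pi (- x).
Proof.
rewrite /yh_opp -lock; apply/yh_piP; rewrite -opprD.
exact: yh_idealN (yh_piK x).
Qed.

Lemma yh_pi_mul x y : yh_mul (yh_pi x) (yh_pi y) = yh_pi (x * y).
Proof.
rewrite /yh_mul -lock; apply/yh_piP; set x' := yh_repr _; set y' := yh_repr _.
have -> : x' * y' - x * y = (x' - x) * y' + x * (y' - y).
  by rewrite mulrBl mulrBr addrA subrK.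
apply: yh_idealD; first exact: yh_idealMr (yh_piK x).
exact: yh_idealMl (yh_piK y).
Qed.

Lemma yh_pi_scale c x : yh_scale c (yh_pi x) = yh_pi (c *: x).
Proof.
rewrite /yh_scale -lock; apply/yh_piP; rewrite -scalerBr.
exact: yh_idealZ (yh_piK x).
Qed.

Lemma yh_addA : associative yh_add.
Proof.
move=> a b c; rewrite -(yh_reprK a) -(yh_reprK b) -(yh_reprK c).
by rewrite !yh_pi_add addrA.
Qed.

Lemma yh_addC : commutative yh_add.
Proof.
by move=> a b; rewrite -(yh_reprK a) -(yh_reprK b) !yh_pi_add addrC.
Qed.

Lemma yh_add0 : left_id (yh_pi 0) yh_add.
Proof. by move=> a; rewrite -(yh_reprK a) yh_pi_add add0r. Qed.

Lemma yh_addN : left_inverse (yh_pi 0) yh_opp yh_add.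
Proof. by move=> a; rewrite -(yh_reprK a) yh_pi_opp yh_pi_add addNr. Qed.

HB.instance Definition _ :=
  GRing.isZmodule.Build Y yh_addA yh_addC yh_add0 yh_addN.

Lemma yh_piD x y : yh_pi (x + y) = yh_pi x + yh_pi y.
Proof. exact/esym/yh_pi_add. Qed.

Lemma yh_mulA : associative yh_mul.
Proof.
move=> a b c; rewrite -(yh_reprK a) -(yh_reprK b) -(yh_reprK c).
by rewrite !yh_pi_mul mulrA.
Qed.

Lemma yh_mul1l : left_id (yh_pi 1) yh_mul.
Proof. by move=> a; rewrite -(yh_reprK a) yh_pi_mul mul1r. Qed.

Lemma yh_mul1r : right_id (yh_pi 1) yh_mul.
Proof. by move=> a; rewrite -(yh_reprK a) yh_pi_mul mulr1. Qed.

Lemma yh_mulDl : left_distributive yh_mul +%R.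
Proof.
move=> a b c; rewrite -(yh_reprK a) -(yh_reprK b) -(yh_reprK c).
by rewrite -yh_piD !yh_pi_mul -yh_piD mulrDl.
Qed.

Lemma yh_mulDr : right_distributive yh_mul +%R.
Proof.
move=> a b c; rewrite -(yh_reprK a) -(yh_reprK b) -(yh_reprK c).
by rewrite -yh_piD !yh_pi_mul -yh_piD mulrDr.
Qed.

Lemma yh_1neq0 : yh_pi 1 != 0.
Proof.
apply/eqP => /yh_piP; rewrite subr0 => /yh_ideal_aug /eqP.
by rewrite rmorph1 oner_eq0.
Qed.

HB.instance Definition _ := GRing.Zmodule_isNzRing.Build Y
  yh_mulA yh_mul1l yh_mul1r yh_mulDl yh_mulDr yh_1neq0.

Lemma yh_piM x y : yh_pi (x * y) = yh_pi x * yh_pi y.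
Proof. exact/esym/yh_pi_mul. Qed.

Lemma yh_scaleA a b v : yh_scale a (yh_scale b v) = yh_scale (a * b) v.
Proof. by rewrite -(yh_reprK v) !yh_pi_scale scalerA. Qed.

Lemma yh_scale1 : left_id 1 yh_scale.
Proof. by move=> v; rewrite -(yh_reprK v) yh_pi_scale scale1r. Qed.

Lemma yh_scaleDr : right_distributive yh_scale +%R.
Proof.
move=> c a b; rewrite -(yh_reprK a) -(yh_reprK b).
by rewrite -yh_piD !yh_pi_scale -yh_piD scalerDr.
Qed.

Lemma yh_scaleDl v : {morph yh_scale^~ v : a b / a + b}.
Proof.
by move=> a b; rewrite -(yh_reprK v) !yh_pi_scale -yh_piD scalerDl.
Qed.

HB.instance Definition _ := GRing.Zmodule_isLmodule.Build K Y
  yh_scaleA yh_scale1 yh_scaleDr yh_scaleDl.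

Lemma yh_piZ (c : K) x : yh_pi (c *: x) = c *: yh_pi x.
Proof. exact/esym/yh_pi_scale. Qed.

Lemma yh_scaleAl (c : K) (a b : Y) : c *: (a * b) = (c *: a) * b.
Proof.
rewrite -(yh_reprK a) -(yh_reprK b) -yh_piM -!yh_piZ -yh_piM.
by rewrite scalerAl.
Qed.

HB.instance Definition _ := GRing.Lmodule_isLalgebra.Build K Y yh_scaleAl.

Lemma yh_scaleAr (c : K) (a b : Y) : c *: (a * b) = a * (c *: b).
Proof.
rewrite -(yh_reprK a) -(yh_reprK b) -yh_piM -!yh_piZ -yh_piM.
by rewrite free_scalerAr.
Qed.

HB.instance Definition _ := GRing.Lalgebra_isAlgebra.Build K Y yh_scaleAr.

Definition yh_g (i : 'I_n.-1) : Y := yh_pi (free_g i).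
Definition yh_t (j : 'I_n) : Y := yh_pi (free_t j).

Lemma yh_pi_zmod : zmod_morphism yh_pi.
Proof. by move=> x y; rewrite yh_piD -scaleN1r yh_piZ scaleN1r. Qed.

Lemma yh_pi_monoid : monoid_morphism yh_pi.
Proof. by split; [|exact: yh_piM]. Qed.

HB.instance Definition _ := GRing.isZmodMorphism.Build _ _ yh_pi yh_pi_zmod.
HB.instance Definition _ :=
  GRing.isMonoidMorphism.Build _ _ yh_pi yh_pi_monoid.

Lemma yh_relations l r : yh_rel q d yh_g yh_t l r -> l = r.
Proof.
move/(@yh_rel_lift _ _ _ _ _ _ free_g free_t yh_pi yh_piZ) => [x [y [xy -> ->]]].
by apply/yh_piP; exact: yh_ideal_rel.
Qed.

(* jm k is J_{k+1}; it is meaningful for k < n only.                           *)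
Fixpoint jm (k : nat) : Y :=
  if k is k'.+1 then
    if insub k' is Some i then yh_g i * jm k' * yh_g i else 1
  else 1.

End YokonumaHecke.

Section Representations.
Variables (K : fieldType) (V : lmodType K).

Record representation (A : algType K) := Representation {
  act :> A -> V -> V;
  act_linearl : forall v, linear (act^~ v);
  act_linearr : forall a, linear (act a);
  act1 : forall v, act 1 v = v;
  actM : forall a b v, act (a * b) v = act a (act b v) }.

(* No finiteness assumption is made on V: b is a basis in the algebraic sense. *)
Definition is_basis (I : choiceType) (b : I -> V) : Prop :=
  forall v, exists! c : {fsfun I -> K with 0},
    v = \sum_(i <- finsupp c) c i *: b i.

Definition diagonalisable (f : V -> V) : Prop :=
  exists (I : choiceType) (b : I -> V),
    is_basis b /\ forall i, exists a : K, f (b i) = a *: b i.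

Definition subalg_gen (A : algType K) (s : seq A) : set A :=
  [set a | forall B : {pred A}, GRing.subalg_closed B -> {subset s <= B} -> a \in B].

Definition stable (A : algType K) (rho : representation A) (B : set A)
    (U : {pred V}) : Prop :=
  forall a, B a -> {in U, forall u, rho a u \in U}.

Definition complementary (U W : {pred V}) : Prop :=
  (forall v, exists2 u, u \in U & exists2 w, w \in W & v = u + w) /\
  (forall v, v \in U -> v \in W -> v = 0).

(* Every stable subspace has a stable complement, as in mxrepresentation's     *)
(* mx_completely_reducible.                                                    *)
Definition completely_reducible (A : algType K) (rho : representation A)
    (B : set A) : Prop :=
  forall U : {pred V}, GRing.submod_closed U -> stable rho B U ->
    exists W : {pred V},
      [/\ GRing.submod_closed W, stable rho B W & complementary U W].

End Representations.

Section Spectrum.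
Variables (K : fieldType) (q : K) (d n : nat).
Local Notation Y := (yokonuma_hecke q d n).
Local Notation t := (yh_t q d).
Local Notation g := (yh_g q d).
Local Notation J := (jm q d n).

Definition jm_admissible (V : lmodType K) (rho : representation V Y) : Prop :=
  (forall i : 'I_n, diagonalisable (rho (t i)) /\ diagonalisable (rho (J i))) /\
  (forall i : 'I_n.-1, completely_reducible rho
     (subalg_gen [:: t (ord_lo i); t (ord_hi i); J i; J i.+1; g i])).

(* Row 0 of L holds the eigenvalues a_i of the t_i, row 1 those c_i of the J_i. *)
Definition spec_jm : set 'M[K]_(2, n) :=
  [set L | exists (V : lmodType K) (rho : representation V Y) (v : V),
     [/\ jm_admissible rho, v != 0
       & forall i : 'I_n, rho (t i) v = L 0 i *: v /\ rho (J i) v = L 1 i *: v]].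

End Spectrum.

Arguments spec_jm {K} q d n.

(* C(q), with the complex numbers built over a model R of the real numbers.    *)
Notation Cq R := {fraction {poly R[i]}}.
Definition Cq_q (R : realType) : Cq R := tofrac 'X.

Section Tableaux.
Variables d n : nat.

(* A partition is the weakly decreasing sequence of its nonzero parts.         *)
Definition is_partition (s : seq nat) : bool := sorted geq s && (0%N \notin s).

Definition is_dpartition (la : {ffun 'I_d -> seq nat}) : Prop :=
  (forall k, is_partition (la k)) /\ (\sum_(k < d) sumn (la k))%N = n.

(* (x, y, k) is the node in row x and column y (0-based) of the k-th diagram.  *)
Definition dnode : Type := (nat * nat * 'I_d)%type.

Definition dnodes (la : {ffun 'I_d -> seq nat}) : set dnode :=
  [set c | (c.1.2 < nth 0 (la c.2) c.1.1)%N].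

Definition is_standard (T : {ffun 'I_n -> dnode}) : Prop :=
  forall i j : 'I_n, (T i).2 = (T j).2 ->
    ((T i).1.1 = (T j).1.1 -> (T i).1.2 < (T j).1.2 -> i < j)%N /\
    ((T i).1.2 = (T j).1.2 -> (T i).1.1 < (T j).1.1 -> i < j)%N.

(* Pairs of a shape and a standard tableau of that shape; a tableau sends the  *)
(* entry i+1, for i : 'I_n, to the node containing it.                         *)
Definition stab : set ({ffun 'I_d -> seq nat} * {ffun 'I_n -> dnode}) :=
  [set T : {ffun 'I_d -> seq nat} * {ffun 'I_n -> dnode} |
     [/\ is_dpartition T.1, set_bij [set: 'I_n] (dnodes T.1) T.2
      & is_standard T.2]].

End Tableaux.

Arguments stab d n : clear implicits.

(* Main.v *)
Require Import Defs.
From mathcomp Require Import all_boot all_order fingroup perm all_algebra.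
From mathcomp Require Import cyclic separable cyclotomic finmap.
From mathcomp Require Import boolp classical_sets functions reals complex monalg.
From mathcomp Require Import zify ring.

Set Implicit Arguments.
Unset Strict Implicit.
Unset Printing Implicit Defensive.

Import Order.TTheory GRing.Theory Num.Theory.

(** Read a standard d-tableau as the word of the letters (k, z), where the node
    containing the j-th entry lies in the k-th diagram and has content z, that
    is, column minus row.  The bijection sends the tableau with letters
    (k_j, z_j) to the array with a_j = zeta^k_j and c_j = q^(2 z_j), for zeta a
    fixed primitive d-th root of unity.  Both sides are compared with the
    combinatorial notion of a content word.

    Tableaux and content words.  The nodes of colour k and content z form a
    diagonal, and a diagram is determined by the lengths h(k, z) of its
    diagonals.  A node of content z can be added to it exactly when
    h(k, z - 1) = h(k, z) + [z > 0] and h(k, z + 1) = h(k, z) + [z < 0].  A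
    content word is a word each of whose letters can be added to the diagonal
    lengths counted by the preceding letters.  The j-th letter and the number
    of its earlier occurrences give back the node that contains the j-th entry,
    so that standard tableaux and content words correspond one to one
    (stab_content, stab_word_inj, word_tableau_stab).

    The spectrum consists of content words.  Let v be a weight vector.  If the
    eigenvalues at i and i+1 are those of letters that do not interact (of
    different colours, or with contents at distance at least 2), then a
    correction g_i v - a v is a non-zero weight vector for the array with
    columns i and i+1 exchanged.  Diagonalisability of J_(i+1) forbids equal
    adjacent letters.  Complete reducibility makes v an eigenvector of g_i when
    the letters have the same colour and adjacent contents, and the braid
    relation then forbids the patterns z, z+1, z and z, z-1, z
    (spec_neq, spec_swap, spec_no_sandwich).  A set of words closed under these
    exchanges, avoiding these patterns and equal adjacent letters, and whose
    words start with content 0, contains only content words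
    (exchange_content): bringing two equal letters together by exchanges, or
    bringing a letter to the front, produces a forbidden configuration unless
    the neighbouring contents occur in between.

    Content words belong to the spectrum.  Young's seminormal formulas are
    written on functions on the rearrangements of a content word that are again
    content words: g_i acts by f |-> coef f + phi (f o s_i), where coef and phi
    depend on the letters at i and i+1, and phi vanishes whenever s_i leads out
    of the content words.  The relations reduce to rational identities between
    the numbers coef, and t_j and J_j are diagonal (seminormal_J).  Condition
    (ii) holds because the space is the sum of the finitely many subspaces
    spanned by an indicator function and its image under g_i, each of which is
    simple (pair_block_simple, simple_sum_completely_reducible). *)

(** * Contents and colours of words *)

Section Words.
Variable d : nat.
Local Notation letter := ('I_d * int)%type.
Implicit Types (w : nat -> letter) (x y : letter) (m p r i : nat) (e : int).

Definition shift x e : letter := (x.1, (x.2 + e)%R).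

Definition cnt w m x : nat := \sum_(j < m) (w j == x).

(** The condition, read on the lengths [h] of the diagonals, that a node of
    colour [x.1] and content [x.2] can be added: the diagonals through its left
    and upper neighbours contain these neighbours, and the diagonals through
    its right and lower neighbours do not reach them. *)
Definition addable (h : letter -> nat) x : bool :=
  all (fun e => h (shift x e) == h x + (e * x.2 < 0)%R)%N [:: 1%R; (-1)%R].

Definition content_word n w : bool :=
  [forall m : 'I_n, addable (cnt w m) (w m)].

(** Two nodes whose letters are not linked can be added independently, in either
    order. *)
Definition linked x y : bool :=
  (x.1 == y.1) && (`|x.2 - y.2|%N <= 1)%N.

Definition swap i w : nat -> letter :=
  fun j => if j == i then w i.+1 else if j == i.+1 then w i else w j.

Lemma shiftK x e : shift (shift x e) (- e) = x.
Proof. by case: x => k z; rewrite /shift /= addrK. Qed.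

Lemma shiftNK x e : shift (shift x (- e)) e = x.
Proof. by case: x => k z; rewrite /shift /= subrK. Qed.

(** Treating both neighbouring contents at once, through a sign [e], halves the
    case analysis below. *)
Lemma addableP h x : reflect
  (forall e, `|e|%N = 1%N -> h (shift x e) = (h x + (e * x.2 < 0)%R)%N) (addable h x).
Proof.
apply: (iffP idP) => [/= /and3P[/eqP h1 /eqP hN1 _] e e1|H].
  have [->|->] : e = 1%R \/ e = (-1)%R by lia.
    exact: h1.
  exact: hN1.
by rewrite /addable /= !H ?eqxx.
Qed.

Lemma content_wordP n w :
  reflect (forall m, (m < n)%N -> addable (cnt w m) (w m)) (content_word n w).
Proof.
apply: (iffP forallP) => [H m mn|H m]; first exact: (H (Ordinal mn)).
exact: H (ltn_ord m).
Qed.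

Lemma cnt0 w x : cnt w 0 x = 0. Proof. exact: big_ord0. Qed.

Lemma cntS w m x : cnt w m.+1 x = (cnt w m x + (w m == x))%N.
Proof. exact: big_ord_recr. Qed.

Lemma cnt_stable w p m x : (p <= m)%N ->
  (forall r, (p <= r < m)%N -> w r != x) -> cnt w m x = cnt w p x.
Proof.
elim: m => [|m IH]; first by rewrite leqn0 => /eqP ->.
rewrite leq_eqVlt => /predU1P[->//|pm] H.
rewrite cntS (negPf (H m _)) ?addn0 ?IH //; first by move=> r r1; apply: H; lia.
by lia.
Qed.

Lemma linkedP x y : reflect (y = x \/ exists2 e, `|e|%N = 1%N & y = shift x e)
  (linked x y).
Proof.
case: x y => [k z] [k' z']; apply: (iffP andP) => /= [[/eqP -> le1]|].
  have [->|ne] := eqVneq z' z; [by left|right].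
  by exists (z' - z)%R; [lia|rewrite /shift /= addrC subrK].
by case=> [[-> ->]|[e e1 [-> ->]]]; split; rewrite ?eqxx //; lia.
Qed.

Lemma linked_sym x y : linked x y = linked y x.
Proof. by rewrite /linked eq_sym; congr andb; lia. Qed.

Lemma swapL i w : swap i w i = w i.+1. Proof. by rewrite /swap eqxx. Qed.

Lemma swapR i w : swap i w i.+1 = w i.
Proof. by rewrite /swap eqxx eqn_leq ltnn. Qed.

Lemma swapO i w j : j != i -> j != i.+1 -> swap i w j = w j.
Proof. by rewrite /swap => /negPf -> /negPf ->. Qed.

Lemma cnt_eq w w' m : (forall j, (j < m)%N -> w j = w' j) -> cnt w m =1 cnt w' m.
Proof. by move=> E x; apply: eq_bigr => j _; rewrite E. Qed.

Lemma cnt_swap i w m x : m != i.+1 -> cnt (swap i w) m x = cnt w m x.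
Proof.
move=> mi; have [le|lt] := leqP m i.
  by apply: cnt_eq => j jm; rewrite swapO //; lia.
have /subnKC <- : (i.+2 <= m)%N by lia.
elim: (m - _)%N => [|k IH].
  rewrite addn0 !cntS swapL swapR addnAC; congr (_ + _ + _)%N.
  by apply: cnt_eq => j jm; rewrite swapO //; lia.
by rewrite addnS 2!cntS IH swapO //; lia.
Qed.

Lemma addable_cntS w m x : ~~ linked (w m) x ->
  addable (cnt w m.+1) x = addable (cnt w m) x.
Proof.
move=> nl; apply: eq_in_all => e e1.
rewrite !cntS; have -> : w m == x = false.
  by apply: contraNF nl => /eqP ->; apply/linkedP; left.
rewrite (_ : w m == shift x e = false) ?addn0 //.
apply: contraNF nl => /eqP ->; rewrite linked_sym.
by apply/linkedP; right; exists e => //; move: e1; rewrite !inE => /orP[]/eqP ->.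
Qed.

Lemma addable_ext h h' x : h =1 h' -> addable h x = addable h' x.
Proof. by move=> E; apply: eq_all => e; rewrite !E. Qed.

Lemma content_swap n w i : (i.+1 < n)%N -> ~~ linked (w i) (w i.+1) ->
  content_word n w -> content_word n (swap i w).
Proof.
move=> lin nl /content_wordP W; apply/content_wordP => m mn.
have [->|mi] := eqVneq m i.+1.
  rewrite swapR addable_cntS ?swapL 1?linked_sym //.
  rewrite (@addable_ext _ (cnt w i)) ?W //; first lia.
  by move=> x; apply: cnt_swap; lia.
rewrite (@addable_ext _ (cnt w m)) => [|x]; last exact: cnt_swap.
have [->|mi'] := eqVneq m i; first by rewrite swapL -addable_cntS ?W.
by rewrite swapO ?W.
Qed.

Lemma content_neq n w i : (i.+1 < n)%N -> content_word n w -> w i != w i.+1.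
Proof.
move=> lin /content_wordP W; apply/eqP => E.
have /addableP/(_ 1%R erefl) := W _ lin; have /addableP/(_ 1%R erefl) := W i (ltnW lin).
rewrite -E !cntS eqxx (_ : w i == shift _ _ = false) ?addn0; first lia.
by apply/eqP; case: (w i) => k z []; lia.
Qed.

(** After a letter [x] is placed, both [x + 1] and [x - 1] have to be placed before
    [x] is possible again. *)
Lemma content_no_sandwich n w i e : `|e|%N = 1%N -> (i.+2 < n)%N -> content_word n w ->
  w i.+2 = w i -> w i.+1 <> shift (w i) e.
Proof.
move=> e1 lin /content_wordP W E2 E1.
have eN : `|(- e)%R|%N = 1%N by lia.
have ne f x : `|f|%N = 1%N -> x == shift x f = false.
  by move=> f1; apply/eqP; case: x => k z []; lia.
have ne' f x : `|f|%N = 1%N -> shift x f == x = false.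
  by move=> f1; rewrite eq_sym ne.
have /addableP/(_ _ eN) := W _ lin; have /addableP/(_ _ eN) := W i (ltn_trans (ltnSn _) (ltnW lin)).
rewrite E2 !cntS E1 eqxx !ne ?ne' // ?addn0 (_ : shift (w i) e == _ = false).
  by lia.
by apply/eqP; case: (w i) => k z [] ; lia.
Qed.

Lemma eq_content_word w w' n :
  (forall j, (j < n)%N -> w j = w' j) -> content_word n w = content_word n w'.
Proof.
move=> E; apply: eq_forallb => m; rewrite E //; apply: addable_ext => x.
by apply: cnt_eq => j jm; apply: E; apply: ltn_trans jm _.
Qed.

Lemma content_neq_next w n i :
  (i.+2 < n)%N -> content_word n w -> w i != w i.+2.
Proof.
move=> lin W; apply/eqP => E.
have [lk|nlk] := boolP (linked (w i) (w i.+1)); last first.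
  have := content_neq lin (content_swap (ltnW lin) nlk W).
  by rewrite swapR swapO ?E ?eqxx //; lia.
case/linkedP: lk => [E1|[e e1]].
  by have := content_neq (ltnW lin) W; rewrite E1 eqxx.
exact: content_no_sandwich e1 lin W (esym E).
Qed.

Lemma last_occ (P : pred nat) m :
  (forall j, (j < m)%N -> ~~ P j) \/
  (exists2 p, (p < m)%N & P p /\ forall r, (p < r < m)%N -> ~~ P r).
Proof.
elim: m => [|m [IH|[p pm [Pp IH]]]]; first by left.
  case Pm: (P m).
    by right; exists m => //; split=> // r; lia.
  left=> j; rewrite ltnS leq_eqVlt => /predU1P[->|/IH//]; by rewrite Pm.
case Pm: (P m).
  by right; exists m => //; split=> // r; lia.
right; exists p; first lia.
split=> // r /andP[pr]; rewrite ltnS leq_eqVlt => /predU1P[->|rm]; first by rewrite Pm.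
by apply: IH; rewrite pr.
Qed.

Section Exchange.
Variables (n : nat) (X : (nat -> letter) -> Prop).
Hypothesis X_first : forall w, X w -> (w 0%N).2 = 0%R.
Hypothesis X_neq : forall w i, X w -> (i.+1 < n)%N -> w i <> w i.+1.
Hypothesis X_swap : forall w i, X w -> (i.+1 < n)%N ->
  ~~ linked (w i) (w i.+1) -> X (swap i w).
Hypothesis X_no_sandwich : forall w i e, X w -> `|e|%N = 1%N -> (i.+2 < n)%N ->
  w i.+2 = w i -> w i.+1 <> shift (w i) e.

(** Take a counterexample in which the two equal letters [x] are closest.  A
    neighbour inside the segment that does not interact with [x] can be moved out
    of it, so both ends of the segment are [x - e].  If they coincide this is a
    forbidden pattern; if not, they are two equal letters without
    [(x - e) + e = x] in between, which is a closer counterexample. *)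
Lemma exchange_repeat w p m e : X w -> `|e|%N = 1%N -> (p < m)%N -> (m < n)%N ->
  w p = w m -> ~ (forall r, (p < r < m)%N -> w r <> shift (w p) e).
Proof.
have [N] := ubnP (m - p); elim: N => // N IH in w p m e *.
move=> ltN Xw e1 pm mn E H.
have [E1|ne1] := eqVneq m p.+1.
  by apply: (X_neq (i := p) Xw); rewrite -?E1.
have pm1 : (p.+1 < m)%N by lia.
have lkcase y : linked (w p) y -> y <> w p -> y <> shift (w p) e ->
    y = shift (w p) (- e)%R.
  move=> /linkedP[//|[f f1 ->]] _.
  have [->//|->//] : f = e \/ f = (- e)%R by lia.
(* An inner neighbour that does not interact is moved out of the segment. *)
have [lk|nlk] := boolP (linked (w p) (w p.+1)); last first.
  apply: (IH (swap p w) p.+1 m e) => //; first by lia.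
  - by apply: X_swap => //; lia.
  - by rewrite swapR E swapO //; lia.
  - by move=> r lr; rewrite swapR swapO; [apply: H; lia|lia|lia].
have U1 : w p.+1 = shift (w p) (- e)%R.
  by apply: lkcase => //; [apply/nesym; apply: X_neq => //; lia|apply: H; lia].
case: m => // m in ltN pm mn E H ne1 pm1 *.
have [lk2|nlk2] := boolP (linked (w m) (w m.+1)); last first.
  apply: (IH (swap m w) p m e) => //; first by lia.
  - by apply: X_swap => //; lia.
  - by lia.
  - by rewrite swapL swapO //; lia.
  - by move=> r lr; rewrite !swapO; [apply: H; lia|lia..].
have U2 : w m = shift (w p) (- e)%R.
  apply: lkcase; first by rewrite E linked_sym.
    by rewrite E; apply: X_neq.
  by apply: H; lia.
(* A single inner letter gives a forbidden pattern x, x - e, x. *)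
have [Em|nem] := eqVneq m p.+1.
  move: U1; apply: X_no_sandwich => //; last by rewrite E Em.
    by lia.
  by rewrite -Em.
apply: (IH w p.+1 m e) => //; try lia; first by rewrite U1 U2.
move=> r lr; rewrite U1 shiftNK => Er.
apply: (IH w p r e) => //; try lia.
by move=> s ls; apply: H; lia.
Qed.

(** Without such an earlier letter, the letter at [m] could be moved to the front of
    the word, where the content is 0. *)
Lemma exchange_support w m e : X w -> `|e|%N = 1%N -> (m < n)%N -> (e * (w m).2 < 0)%R ->
  exists2 j, (j < m)%N & w j = shift (w m) e.
Proof.
have [N] := ubnP m; elim: N => // N IH in w m *.
case: m => [_ /X_first -> _ _|m ltN Xw e1 mn neg]; first by rewrite mulr0 ltxx.
have [lk|nlk] := boolP (linked (w m) (w m.+1)); last first.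
  have [|j jm] := IH (swap m w) m ltN (X_swap Xw mn nlk) e1 (ltnW mn).
    by rewrite swapL.
  rewrite swapL.
  by rewrite swapO => [<-||]; [exists j => //; lia|lia..].
have /linkedP[E|[f f1 E]] : linked (w m.+1) (w m) by rewrite linked_sym.
  by case: (X_neq Xw mn).
have [fe|fe] : f = e \/ f = (- e)%R by lia.
  by exists m; rewrite // E fe.
have [|j jm Ej] := IH w m ltN Xw e1 (ltnW mn); first by rewrite E fe /=; lia.
rewrite E fe shiftNK in Ej.
have [||j' jj] := IH w j (ltn_trans jm ltN) Xw e1; [lia|by rewrite Ej|].
by rewrite Ej => <-; exists j' => //; lia.
Qed.

(** The count of [x + e] before position [m] is governed by the last earlier
    occurrence of [x] or [x + e].  This is not [x], by [exchange_repeat]; if it is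
    [x + e], addability at that position gives the required difference of counts;
    if there is none, both counts are 0 and [exchange_support] fixes the sign of
    the content. *)
Lemma exchange_content w : X w -> content_word n w.
Proof.
move=> Xw; apply/content_wordP => m.
have [N] := ubnP m; elim: N => // N IH in m *.
move=> ltN mn; apply/addableP => e e1.
have ne x : x <> shift x e by case: x => k z []; lia.
set x := w m.
have [none|[p pm [Pp lst]]] := last_occ (fun j => w j \in [:: x; shift x e]) m.
  have z0 y : y \in [:: x; shift x e] -> cnt w m y = 0%N.
    move=> yin; rewrite (@cnt_stable w 0 m) ?cnt0 // => r /none.
    by apply: contraNneq => ->.
  rewrite !z0 ?inE ?eqxx ?orbT //.
  case: ltP => // neg; have [j jm Ej] := exchange_support Xw e1 mn neg.
  by have := none _ jm; rewrite Ej !inE eqxx orbT.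
have st y : y \in [:: x; shift x e] -> cnt w m y = cnt w p.+1 y.
  move=> yin; apply: cnt_stable => // r lr.
  by apply: contraNneq (lst r lr) => ->.
rewrite !st ?inE ?eqxx ?orbT // !cntS.
move: Pp; rewrite !inE => /orP[/eqP E|/eqP E].
  exfalso; apply: (@exchange_repeat w p m e) => // r lr Er.
  by have := lst r lr; rewrite Er E !inE eqxx orbT.
have /addableP/(_ (- e)%R) := IH p (leq_trans pm ltN) (ltn_trans pm mn).
rewrite E shiftK eqxx => ->; last by lia.
rewrite (_ : shift x e == x = false) /=; last by apply/eqP => /esym /ne.
by lia.
Qed.

End Exchange.
End Words.

(** * Standard tableaux as content words *)

Section TableauWords.
Variable d : nat.
Local Notation letter := ('I_d * int)%type.
Local Notation dnode := (dnode d).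
Implicit Types (w : nat -> letter) (x : letter) (c : dnode) (m r : nat).

Definition letter_of c : letter := (c.2, (c.1.2%:Z - c.1.1%:Z)%R).

(** The rank of a node on its diagonal, counted from the first row or column. *)
Definition diag_idx c : nat := minn c.1.1 c.1.2.

Definition node x r : dnode :=
  ((r + if (x.2 < 0)%R then `|x.2|%N else 0)%N,
   (r + if (x.2 < 0)%R then 0 else `|x.2|%N)%N, x.1).

(** The diagram whose diagonal of letter [x] has length [cnt w m x]. *)
Definition filled w m c : bool := (diag_idx c < cnt w m (letter_of c))%N.

Lemma letter_of_node x r : letter_of (node x r) = x.
Proof. by case: x => k z; rewrite /letter_of /=; congr (_, _); case: ifP; lia. Qed.

Lemma diag_idx_node x r : diag_idx (node x r) = r.
Proof. by rewrite /diag_idx /=; case: ifP; lia. Qed.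

Lemma node_letter_of c : node (letter_of c) (diag_idx c) = c.
Proof.
case: c => [[a b] k]; rewrite /node /letter_of /diag_idx /=.
by congr (_, _, _); case: ifP; lia.
Qed.

Lemma filledS w m c :
  filled w m.+1 c = filled w m c || (c == node (w m) (cnt w m (w m))).
Proof.
rewrite /filled cntS; case: eqP => [E|ne] /=.
  rewrite addn1 ltnS leq_eqVlt orbC E; congr orb.
  apply/eqP/eqP => [<-|h]; last by rewrite h diag_idx_node -h.
  by rewrite node_letter_of.
rewrite addn0; case: eqP => [E|_]; last by rewrite orbF.
by case: ne; rewrite E letter_of_node.
Qed.

Lemma filled_node w m : ~~ filled w m (node (w m) (cnt w m (w m))).
Proof. by rewrite /filled letter_of_node diag_idx_node ltnn. Qed.

Section Partition.
Variable s : seq nat.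
Hypothesis s_part : is_partition s.

Lemma partition_nth_anti i j : (i <= j)%N -> (nth 0 s j <= nth 0 s i)%N.
Proof.
move=> ij; case: (ltnP j (size s)) => [js|js]; last by rewrite (nth_default _ js).
have /andP[srt _] := s_part.
have tr : transitive geq by move=> p q r' qp pr; exact: leq_trans pr qp.
by apply: (sorted_leq_nth tr (fun p => leqnn p) 0%N srt);
  rewrite ?inE //; exact: leq_ltn_trans js.
Qed.

Lemma partition_size i : (i < size s)%N = (0 < nth 0 s i)%N.
Proof.
case: ltnP => [is_|si]; last by rewrite nth_default.
have /andP[_ n0] := s_part; rewrite lt0n; apply/esym.
by apply: contraNneq n0 => <-; exact: mem_nth.
Qed.

End Partition.

Lemma partition_ext s s' : is_partition s -> is_partition s' ->
  (forall a b, (b < nth 0 s a)%N = (b < nth 0 s' a)%N) -> s = s'.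
Proof.
move=> ps ps' E.
have En a : nth 0 s a = nth 0 s' a.
  by apply/eqP; rewrite eqn_leq leqNgt E ltnn /= leqNgt -E ltnn.
have Es : size s = size s'.
  have sz i : (i < size s)%N = (i < size s')%N by rewrite !partition_size ?En.
  by apply/eqP; rewrite eqn_leq leqNgt sz ltnn leqNgt -sz ltnn.
exact: (eq_from_nth Es (fun i _ => En i)).
Qed.

Variable n' : nat.
Local Notation n := n'.+1.
Implicit Types (la : {ffun 'I_d -> seq nat}) (T : {ffun 'I_n -> dnode}).

Definition tableau_word T : nat -> letter := fun j => letter_of (T (inord j)).

Section FromTableau.
Variables (la : {ffun 'I_d -> seq nat}) (T : {ffun 'I_n -> dnode}).
Hypothesis laT : stab d n (la, T).

Lemma stab_part k : is_partition (la k).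
Proof. by case: laT => -[]. Qed.

Lemma stab_inj i j : T i = T j -> i = j.
Proof. by case: laT => _ [_ inj _] _; apply: inj; rewrite in_setT. Qed.

Lemma stab_diagram i : ((T i).1.2 < nth 0 (la (T i).2) (T i).1.1)%N.
Proof. by case: laT => _ [hom _ _] _; exact: (hom i). Qed.

Lemma stab_entry a b k : (b < nth 0 (la k) a)%N -> exists i, T i = (a, b, k).
Proof.
by case: laT => _ [_ _ sur] _ h; have [|i _ <-] := sur (a, b, k) => //; exists i.
Qed.

Lemma stab_below a b i : (a <= (T i).1.1)%N -> (b <= (T i).1.2)%N ->
  exists2 j : 'I_n, (j <= i)%N & T j = (a, b, (T i).2).
Proof.
move=> ax bx; have := stab_diagram i; case E: (T i) ax bx => [[x y] k] /= ax by_ dg.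
have std := let: And3 _ _ h := laT in h : is_standard T.
have [j1 E1] : exists j, T j = (a, y, k).
  by apply: stab_entry; apply: leq_trans dg (partition_nth_anti (stab_part k) ax).
have [j2 E2] : exists j, T j = (a, b, k).
  apply: stab_entry; apply: leq_ltn_trans by_ _.
  exact: leq_trans dg (partition_nth_anti (stab_part k) ax).
exists j2 => //; apply: (@leq_trans j1).
  have [Eb|bn] := eqVneq b y; first by rewrite (@stab_inj j2 j1) // E1 E2 Eb.
  have /std[h _] : (T j2).2 = (T j1).2 by rewrite E1 E2.
  by apply: ltnW; apply: h; rewrite E1 E2 //=; lia.
have [Ea|an] := eqVneq a x; first by rewrite (@stab_inj j1 i) // E1 E Ea.
have /std[_ h] : (T j1).2 = (T i).2 by rewrite E1 E.
by apply: ltnW; apply: h; rewrite E1 E //=; lia.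
Qed.

Let w := tableau_word T.

Lemma tableau_word_ord (i : 'I_n) : w i = letter_of (T i).
Proof. by rewrite /w /tableau_word inord_val. Qed.

(** The nodes that precede [T i] on its diagonal lie weakly above and to the left of
    it, hence carry smaller entries; so the entry is put at the first free place
    of its diagonal. *)
Lemma stab_step (i : 'I_n) :
  (forall c, reflect (exists2 j : 'I_n, (j < i)%N & T j = c) (filled w i c)) ->
  T i = node (w i) (cnt w i (w i)).
Proof.
move=> F; rewrite tableau_word_ord.
have nf : ~~ filled w i (T i).
  by apply/F => -[j ji /stab_inj E]; rewrite E ltnn in ji.
rewrite -{1}(node_letter_of (T i)); congr node; apply/eqP; rewrite eqn_leq.
rewrite leqNgt andbC; move: (nf); rewrite /filled -leqNgt => -> /=.
apply/negP => lt.
set r := cnt _ _ _ in lt; pose c := node (letter_of (T i)) r.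
have [||j ji Ej] := @stab_below c.1.1 c.1.2 i.
- by move: lt; rewrite /c /diag_idx /letter_of /=; case: ifP; lia.
- by move: lt; rewrite /c /diag_idx /letter_of /=; case: ifP; lia.
have Ec : T j = c by rewrite Ej.
have /negP := ltnn r; apply.
have /F : exists2 j : 'I_n, (j < i)%N & T j = c.
  exists j => //; rewrite ltn_neqAle ji andbT; apply: contraTneq lt => /val_inj E.
  by rewrite -E Ec diag_idx_node ltnn.
by rewrite /filled letter_of_node diag_idx_node.
Qed.

Lemma stab_filled m : (m <= n)%N -> forall c,
  reflect (exists2 j : 'I_n, (j < m)%N & T j = c) (filled w m c).
Proof.
elim: m => [_ c|m IH mn c].
  by apply: (iffP idP) => [|[] //]; rewrite /filled cnt0.
have F := IH (ltnW mn); rewrite filledS.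
have E := @stab_step (Ordinal mn) F; rewrite /= in E; rewrite -E.
apply: (iffP orP) => [[/F[j jm Ej]|/eqP ->]|[j]].
- by exists j => //; apply: ltnW.
- by exists (Ordinal mn).
rewrite ltnS leq_eqVlt => /predU1P[jm <-|jm <-]; last by left; apply/F; exists j.
by right; apply/eqP; congr (T _); apply: val_inj.
Qed.

Lemma stab_node (i : 'I_n) : T i = node (w i) (cnt w i (w i)).
Proof. by apply: stab_step; apply: stab_filled; apply: ltnW. Qed.

(** The left and upper neighbours of a node carry smaller entries and the right and
    lower ones larger entries; translated into lengths of diagonals, this is
    addability. *)
Lemma stab_content : content_word n w.
Proof.
apply/content_wordP => m mn.
pose i : 'I_n := Ordinal mn; rewrite (_ : m = i) //.
have F := @stab_filled i (ltnW (ltn_ord i)).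
have idxE : diag_idx (T i) = cnt w i (letter_of (T i)).
  by rewrite stab_node diag_idx_node letter_of_node.
have fil a b : (a <= (T i).1.1)%N -> (b <= (T i).1.2)%N ->
    (a, b) != (T i).1 -> filled w i (a, b, (T i).2).
  move=> ha hb ne; have [j ji Ej] := stab_below ha hb.
  apply/F; exists j => //; rewrite ltn_neqAle ji andbT.
  by apply: contraNneq ne => /val_inj <-; rewrite Ej.
have nfil a b : ((T i).1.1 <= a)%N -> ((T i).1.2 <= b)%N ->
    ~~ filled w i (a, b, (T i).2).
  move=> ha hb; apply/F => -[j ji Ej].
  have [||j' jj Ej'] := @stab_below (T i).1.1 (T i).1.2 j; rewrite ?Ej //.
  suff E : j' = i by rewrite E in jj; lia.
  by apply: stab_inj; rewrite Ej' Ej; case: (T i) => [[]].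
rewrite tableau_word_ord; move: idxE fil nfil; case: (T i) => [[a b] k] /=.
rewrite /filled /diag_idx /= => idxE fil nfil.
have sh a' b' e : (b'%:Z - a'%:Z = b%:Z - a%:Z + e)%R ->
  letter_of (a', b', k) = shift (letter_of (a, b, k)) e.
  by rewrite /letter_of /shift /= => ->.
apply/addableP => e e1; have [->|->] : e = 1%R \/ e = (-1)%R by lia.
  have := nfil a b.+1 (leqnn _) (leqnSn _); rewrite (sh a b.+1 1%R); last by lia.
  case: a => [|a] in idxE fil nfil sh *; first by rewrite -idxE /=; lia.
  have := fil a b (leqnSn _) (leqnn _); rewrite (sh a b 1%R); last by lia.
  rewrite -idxE /= xpair_eqE (ltn_eqF (ltnSn a)) => /(_ isT); lia.
have := nfil a.+1 b (leqnSn _) (leqnn _); rewrite (sh a.+1 b (-1)%R); last by lia.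
case: b => [|b] in idxE fil nfil sh *; first by rewrite -idxE /=; lia.
have := fil a b (leqnn _) (leqnSn _); rewrite (sh a b (-1)%R); last by lia.
rewrite -idxE /= xpair_eqE (ltn_eqF (ltnSn b)) andbF => /(_ isT); lia.
Qed.

End FromTableau.

(** Node by node, the tableau is recovered from its word by [stab_node], and the
    shape is the set of nodes of the tableau. *)
Lemma stab_word_inj la T la' T' : stab d n (la, T) -> stab d n (la', T') ->
  (forall m, (m < n)%N -> tableau_word T m = tableau_word T' m) -> (la, T) = (la', T').
Proof.
move=> S S' E.
have ET : T = T'.
  apply/ffunP => i; rewrite (stab_node S) (stab_node S') E //; congr node.
  by apply: cnt_eq => j ji; apply: E; exact: ltn_trans ji (ltn_ord i).
rewrite -ET in S' *; congr pair; apply/ffunP => k.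
apply: partition_ext (stab_part S k) (stab_part S' k) _ => a b.
apply/idP/idP => [/(stab_entry S)|/(stab_entry S')] [i Ei].
  by have := stab_diagram S' i; rewrite Ei.
by have := stab_diagram S i; rewrite Ei.
Qed.

(** Turns a down-closed set of columns (or rows) into a row (or column) length. *)
Lemma downset_size (s : seq nat) : uniq s ->
  (forall b, b.+1 \in s -> b \in s) -> forall b, (b \in s) = (b < size s)%N.
Proof.
move=> us dn.
have sub b : b \in s -> {subset iota 0 b.+1 <= s}.
  elim: b => [|b IH] bs y; first by rewrite inE => /eqP ->.
  rewrite mem_iota add0n /= ltnS leq_eqVlt => /predU1P[->//|yb].
  by apply: (IH (dn _ bs)); rewrite mem_iota.
have lt b : b \in s -> b \in iota 0 (size s).
  move=> bs; rewrite mem_iota /= -(size_iota 0 b.+1).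
  by apply: uniq_leq_size (iota_uniq _ _) (sub _ bs).
have [|_ eqs] := uniq_min_size us lt; first by rewrite size_iota.
by move=> b; rewrite eqs mem_iota.
Qed.

Section FromWord.
Variable w : nat -> letter.
Hypothesis Ww : content_word n w.

(** Adjacent diagonals of a diagram have lengths that differ by at most one, with a
    sign depending on the side of the main diagonal.  Adding an addable node
    switches such a difference between its two possible values. *)
Lemma content_profile m x e : (m <= n)%N -> `|e|%N = 1%N ->
  (cnt w m (shift x e) <= cnt w m x + (e * x.2 < 0)%R)%N.
Proof.
move=> + e1; elim: m => [_|m IH mn]; first by rewrite !cnt0.
have {}IH := IH (ltnW mn); rewrite !cntS.
have [E|ne] /= := eqVneq; last by rewrite addn0; apply: leq_trans IH _; lia.
have /content_wordP/(_ m mn)/addableP/(_ (- e)%R) := Ww.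
rewrite E shiftK => ->; last by lia.
by rewrite /=; lia.
Qed.

Lemma filled_left m a b k : (m <= n)%N -> filled w m (a, b.+1, k) -> filled w m (a, b, k).
Proof.
rewrite /filled /diag_idx /letter_of /= => mn.
have := @content_profile m (k, (b%:Z - a%:Z)%R) 1%R mn erefl.
have -> : shift (k, (b%:Z - a%:Z)%R) 1%R = (k, (b.+1%:Z - a%:Z)%R).
  by rewrite /shift /=; congr (_, _); lia.
by rewrite /=; lia.
Qed.

Lemma filled_up m a b k : (m <= n)%N -> filled w m (a.+1, b, k) -> filled w m (a, b, k).
Proof.
rewrite /filled /diag_idx /letter_of /= => mn.
have := @content_profile m (k, (b%:Z - a%:Z)%R) (-1)%R mn erefl.
have -> : shift (k, (b%:Z - a%:Z)%R) (-1)%R = (k, (b%:Z - a.+1%:Z)%R).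
  by rewrite /shift /=; congr (_, _); lia.
by rewrite /=; lia.
Qed.

Lemma filled_down m a b a' b' k : (m <= n)%N -> (a' <= a)%N -> (b' <= b)%N ->
  filled w m (a, b, k) -> filled w m (a', b', k).
Proof.
move=> mn /subnKC <- /subnKC <-; elim: (a - a')%N => [|p IH].
  rewrite addn0; elim: (b - b')%N => [|p IH]; first by rewrite addn0.
  by rewrite addnS => /(filled_left mn).
by rewrite addnS => /(filled_up mn).
Qed.

Definition word_tableau : {ffun 'I_n -> dnode} := [ffun i : 'I_n => node (w i) (cnt w i (w i))].

Lemma tableau_word_tableau m : (m < n)%N -> tableau_word word_tableau m = w m.
Proof. by move=> mn; rewrite /tableau_word ffunE letter_of_node inordK. Qed.

Lemma filledP m c : (m <= n)%N ->
  reflect (exists2 i : 'I_n, (i < m)%N & word_tableau i = c) (filled w m c).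
Proof.
elim: m c => [c _|m IH c mn]; first by apply: (iffP idP) => [|[] //]; rewrite /filled cnt0.
have {}IH := IH _ (ltnW mn); rewrite filledS; apply: (iffP orP) => [[/IH[i im Ei]|/eqP ->]|[k]].
- by exists i => //; apply: ltnW.
- by exists (Ordinal mn); rewrite ?ffunE.
rewrite ltnS leq_eqVlt => /predU1P[im <-|im <-]; last by left; apply/IH; exists k.
by right; rewrite ffunE im.
Qed.

Lemma filled_word_tableau (i : 'I_n) m : (m <= n)%N -> filled w m (word_tableau i) = (i < m)%N.
Proof.
move=> mn; apply/(filledP _ mn)/idP => [[j jm E]|im]; last by exists i.
rewrite ltnNge; apply/negP => mi.
have := filled_node w i; rewrite (_ : node _ _ = word_tableau i); last by rewrite ffunE.
rewrite -E.
by apply/negP/negPn/(filledP _ (ltnW (ltn_ord i))); exists j => //; exact: leq_trans jm mi.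
Qed.

Lemma word_tableau_inj : injective word_tableau.
Proof.
move=> i j E; apply: val_inj; apply/eqP; rewrite eqn_leq.
rewrite -ltnS -(filled_word_tableau i (ltn_ord j)) E filled_word_tableau ?ltnSn //=.
by rewrite -ltnS -(filled_word_tableau j (ltn_ord i)) -E filled_word_tableau ?ltnSn.
Qed.

Let row k a := [seq (word_tableau i).1.2 | i <- enum 'I_n & ((word_tableau i).1.1 == a) && ((word_tableau i).2 == k)].
Let column k := [seq (word_tableau i).1.1 | i <- enum 'I_n & ((word_tableau i).1.2 == 0%N) && ((word_tableau i).2 == k)].

Lemma mem_row k a b : (b \in row k a) = filled w n (a, b, k).
Proof.
apply/idP/idP => [/mapP[k0]|/(filledP _ (leqnn n))[i _ Ei]].
  rewrite mem_filter => /andP[/andP[/eqP <- /eqP <-] _] ->.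
  by apply/(filledP _ (leqnn n)); exists k0 => //; case: (word_tableau k0) => [[]].
by apply/mapP; exists i; rewrite 1?mem_filter ?Ei /= ?eqxx ?mem_enum.
Qed.

Lemma mem_column k a : (a \in column k) = filled w n (a, 0%N, k).
Proof.
apply/idP/idP => [/mapP[k0]|/(filledP _ (leqnn n))[i _ Ei]].
  rewrite mem_filter => /andP[/andP[/eqP <- /eqP <-] _] ->.
  by apply/(filledP _ (leqnn n)); exists k0 => //; case: (word_tableau k0) => [[]].
by apply/mapP; exists i; rewrite 1?mem_filter ?Ei /= ?eqxx ?mem_enum.
Qed.

Lemma row_size k a b : (b < size (row k a))%N = filled w n (a, b, k).
Proof.
rewrite -downset_size ?mem_row //.
  rewrite map_inj_in_uniq 1?filter_uniq ?enum_uniq // => i j.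
  rewrite !mem_filter => /andP[/andP[/eqP i1 /eqP i2] _] /andP[/andP[/eqP j1 /eqP j2] _].
  move=> E; apply: word_tableau_inj; move: E i1 i2 j1 j2.
  by case: (word_tableau i) (word_tableau j) => [[? ?] ?] [[? ?] ?] /= -> -> -> -> ->.
by move=> b'; rewrite !mem_row; exact: filled_left.
Qed.

Lemma column_size k a : (a < size (column k))%N = filled w n (a, 0%N, k).
Proof.
rewrite -downset_size ?mem_column //.
  rewrite map_inj_in_uniq 1?filter_uniq ?enum_uniq // => i j.
  rewrite !mem_filter => /andP[/andP[/eqP i1 /eqP i2] _] /andP[/andP[/eqP j1 /eqP j2] _].
  move=> E; apply: word_tableau_inj; move: E i1 i2 j1 j2.
  by case: (word_tableau i) (word_tableau j) => [[? ?] ?] [[? ?] ?] /= -> -> -> -> ->.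
by move=> b'; rewrite !mem_column; exact: filled_up.
Qed.

Definition word_shape : {ffun 'I_d -> seq nat} :=
  [ffun k => mkseq (fun a => size (row k a)) (size (column k))].

Lemma word_shape_filled a b k : (b < nth 0 (word_shape k) a)%N = filled w n (a, b, k).
Proof.
rewrite ffunE; case: (ltnP a (size (column k))) => [ac|ca].
  by rewrite nth_mkseq // row_size.
rewrite nth_default ?size_mkseq // ltn0; apply/esym/negP => /(filled_down (leqnn n) (leqnn a) (leq0n b)).
by rewrite -column_size ltnNge ca.
Qed.

Lemma word_shape_partition k : is_partition (word_shape k).
Proof.
rewrite /is_partition; apply/andP; split.
  apply/(sortedP 0%N) => a _; rewrite /geq /= leqNgt; apply/negP.
  rewrite word_shape_filled => /(filled_up (leqnn n)).
  by rewrite -word_shape_filled ltnn.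
apply/(nthP 0%N) => -[a]; rewrite {1}ffunE size_mkseq column_size -word_shape_filled.
by move=> + E; rewrite E.
Qed.

Lemma word_shape_size : (\sum_(k < d) sumn (word_shape k))%N = n.
Proof.
transitivity (\sum_(k < d) \sum_(i < n | (word_tableau i).2 == k) 1)%N; last first.
  rewrite (exchange_big_dep xpredT) //= (eq_bigr (fun=> 1%N)) ?sum1_card ?card_ord //.
  by move=> i _; rewrite (big_pred1 (word_tableau i).2).
apply: eq_bigr => k _; rewrite ffunE sumnE big_map -[X in iota 0 X]subn0 big_mkord.
rewrite (eq_bigr (fun a : 'I_(size (column k)) =>
    \sum_(i < n | ((word_tableau i).1.1 == a) && ((word_tableau i).2 == k)) 1)%N); last first.
  by move=> a _; rewrite size_map size_filter -sum1_count big_enum_cond.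
rewrite (exchange_big_dep (fun i => (word_tableau i).2 == k)) /=; last by move=> ? ? _ /andP[].
apply: eq_bigr => i /eqP ik.
have ac : ((word_tableau i).1.1 < size (column k))%N.
  rewrite column_size -ik; apply: (@filled_down n (word_tableau i).1.1 (word_tableau i).1.2) => //.
  by rewrite -!surjective_pairing filled_word_tableau.
by rewrite (big_pred1 (Ordinal ac)) // => a; rewrite ik eqxx andbT eq_sym.
Qed.

Lemma word_tableau_stab : stab d n (word_shape, word_tableau).
Proof.
split=> /=.
- by split; [exact: word_shape_partition|exact: word_shape_size].
- split=> [i _|i j _ _ /word_tableau_inj//|[[a b] k]] /=.
    by rewrite /dnodes /= word_shape_filled -!surjective_pairing filled_word_tableau.
  by rewrite /dnodes /= word_shape_filled => /(filledP _ (leqnn n))[i _ Ei]; exists i.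
move=> i j E2; split=> E1 lt.
  have : filled w j.+1 (word_tableau i).
    rewrite [word_tableau i]surjective_pairing [(word_tableau i).1]surjective_pairing E1 E2.
    apply: (@filled_down j.+1 (word_tableau j).1.1 (word_tableau j).1.2) => //; first exact: ltnW.
    by rewrite -!surjective_pairing filled_word_tableau.
  rewrite filled_word_tableau // ltnS leq_eqVlt => /predU1P[/val_inj E|//].
  by rewrite E ltnn in lt.
have : filled w j.+1 (word_tableau i).
  rewrite [word_tableau i]surjective_pairing [(word_tableau i).1]surjective_pairing E1 E2.
  apply: (@filled_down j.+1 (word_tableau j).1.1 (word_tableau j).1.2) => //; first exact: ltnW.
  by rewrite -!surjective_pairing filled_word_tableau.
rewrite filled_word_tableau // ltnS leq_eqVlt => /predU1P[/val_inj E|//].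
by rewrite E ltnn in lt.
Qed.

End FromWord.
End TableauWords.

(** * Relations in the algebra and linear algebra of representations *)

Local Open Scope ring_scope.

(** The eigenvalue of e_i on a vector on which t_i and t_(i+1) act by [a] and [b]. *)
Lemma root_unity_sum (K : fieldType) (d : nat) (a b : K) :
    d%:R != 0 :> K -> a ^+ d = 1 -> b ^+ d = 1 ->
  d%:R^-1 * (\sum_(s < d) a ^+ s * b ^+ (d - s)) = (a == b)%:R.
Proof.
move=> d0 ad bd; case: eqVneq => [->|ne].
  rewrite (eq_bigr (fun=> 1)) => [|s _]; last first.
    by rewrite -exprD subnKC // ltnW.
  by rewrite sumr_const card_ord mulVf.
apply/eqP; rewrite mulf_eq0; apply/orP; right.
have -> : \sum_(s < d) a ^+ s * b ^+ (d - s) = b * \sum_(s < d) b ^+ (d.-1 - s) * a ^+ s.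
  rewrite mulr_sumr; apply: eq_bigr => s _.
  rewrite mulrA -exprS mulrC; congr (_ ^+ _ * _).
  by have := ltn_ord s; lia.
have := subrXX b a d; rewrite ad bd subrr => /esym/eqP.
rewrite mulf_eq0 subr_eq0 eq_sym (negPf ne) /= => /eqP.
rewrite (eq_bigr (fun s : 'I_d => b ^+ (d.-1 - s) * a ^+ s)) => [->|s _].
  by rewrite mulr0.
by [].
Qed.

Section JucysMurphyAlgebra.
Variables (K : fieldType) (q : K) (d n : nat).
Local Notation Y := (yokonuma_hecke q d n).
Local Notation t := (@yh_t K q d n).
Local Notation g := (@yh_g K q d n).
Local Notation J := (jm q d n).
Implicit Types i j : 'I_n.-1.

Lemma g_far i j : (i.+1 < j)%N || (j.+1 < i)%N -> g i * g j = g j * g i.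
Proof. by move=> ij; apply: yh_relations; exact: yh_rel_far. Qed.

Lemma g_braid i j : j = i.+1 :> nat -> g i * g j * g i = g j * g i * g j.
Proof. by move=> ij; apply: yh_relations; exact: yh_rel_braid. Qed.

Lemma t_g i (k : 'I_n) : t k * g i = g i * t (tperm (ord_lo i) (ord_hi i) k).
Proof. by apply: yh_relations; exact: yh_rel_tg. Qed.

Lemma t_order (k : 'I_n) : t k ^+ d = 1.
Proof. by apply: yh_relations; exact: yh_rel_order. Qed.

Lemma g_quad i : g i * g i = 1 + (q - q^-1) *: (yh_e d t i * g i).
Proof. by rewrite -expr2; apply: yh_relations; exact: yh_rel_quad. Qed.

Lemma jmS i : J i.+1 = g i * J i * g i.
Proof. by rewrite /= valK. Qed.

Lemma jm_comm_lt i k : (k < i)%N -> J k * g i = g i * J k.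
Proof.
elim: k => [|k IH] ki; first by rewrite mul1r mulr1.
have [j Ek] : {j : 'I_n.-1 | k = j :> nat}.
  by exists (Ordinal (ltn_trans (ltnW ki) (ltn_ord i))).
subst k; rewrite jmS -mulrA g_far ?ki // mulrA -[g _ * _ * g i]mulrA.
by rewrite IH 1?ltnW // !mulrA g_far ?ki.
Qed.

(** Only the first case needs the braid relation: it moves g_i through
    g_(i+1) g_i J_i g_i g_(i+1) from one end to the other. *)
Lemma jm_comm_gt i k : (i.+1 < k)%N -> (k < n)%N -> J k * g i = g i * J k.
Proof.
elim: k => // k IH; rewrite ltnS leq_eqVlt => ik kn.
have [j Ek] : {j : 'I_n.-1 | k = j :> nat}.
  by have kn' : (k < n.-1)%N by [lia]; exists (Ordinal kn').
subst k; rewrite jmS; case/predU1P: ik => ik.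
  rewrite -ik jmS; set h := g j.
  have br : g i * h * g i = h * g i * h by apply: g_braid.
  have cm : J i * h = h * J i by apply: jm_comm_lt; rewrite -ik.
  transitivity (h * g i * J i * (g i * h * g i)); first by rewrite !mulrA.
  rewrite br; transitivity (h * g i * (J i * h) * g i * h); first by rewrite !mulrA.
  by rewrite cm mulrA -br !mulrA.
rewrite -mulrA -(g_far (i := i)) ?ik // mulrA -[g _ * _ * g i]mulrA.
by rewrite (IH ik (ltnW kn)) !mulrA (g_far (i := i)) ?ik.
Qed.

End JucysMurphyAlgebra.

Section Action.
Variables (K : fieldType) (V : lmodType K) (A : algType K) (rho : representation V A).

Lemma actDr a u v : rho a (u + v) = rho a u + rho a v.
Proof. by have := act_linearr rho a 1 u v; rewrite !scale1r. Qed.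

Lemma act0r a : rho a 0 = 0.
Proof. by have := actDr a 0 0; rewrite addr0 => /eqP; rewrite -subr_eq subrr eq_sym => /eqP. Qed.

Lemma actZr a c v : rho a (c *: v) = c *: rho a v.
Proof. by have := act_linearr rho a c v 0; rewrite !addr0 act0r addr0. Qed.

Lemma actBr a u v : rho a (u - v) = rho a u - rho a v.
Proof. by rewrite actDr -scaleN1r actZr scaleN1r. Qed.

Lemma actDl a b v : rho (a + b) v = rho a v + rho b v.
Proof. by have := act_linearl rho v 1 a b; rewrite !scale1r. Qed.

Lemma act0l v : rho 0 v = 0.
Proof. by have := actDl 0 0 v; rewrite addr0 => /eqP; rewrite -subr_eq subrr eq_sym => /eqP. Qed.

Lemma actZl c a v : rho (c *: a) v = c *: rho a v.
Proof. by have := act_linearl rho v c a 0; rewrite !addr0 act0l addr0. Qed.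

Lemma act_suml (I : finType) (F : I -> A) v :
  rho (\sum_i F i) v = \sum_i rho (F i) v.
Proof. by elim/big_rec2: _ => [|i y1 y2 _ <-]; rewrite ?act0l ?actDl. Qed.

Lemma act_exp a c v k : rho a v = c *: v -> rho (a ^+ k) v = c ^+ k *: v.
Proof.
move=> E; elim: k => [|k IH]; first by rewrite !expr0 act1 scale1r.
by rewrite exprS actM IH actZr E scalerA -exprSr.
Qed.

(** The elements of the algebra that preserve a subspace form a subalgebra. *)
Lemma stable_subalg_gen (s : seq A) (U : {pred V}) : GRing.submod_closed U ->
  (forall a, a \in s -> {in U, forall u, rho a u \in U}) ->
  stable rho (subalg_gen s) U.
Proof.
move=> [U0 Ul] H a ga.
pose B : {pred A} := fun a => `[< {in U, forall u, rho a u \in U} >].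
suff : a \in B by move/asboolP.
apply: ga => [|b bs]; last by apply/asboolP; exact: H.
split=> [|c x y /asboolP Bx /asboolP By|x y /asboolP Bx /asboolP By]; apply/asboolP => u Uu.
- by rewrite act1.
- by rewrite actDl actZl; apply: Ul; [exact: Bx|exact: By].
- by rewrite actM; apply/Bx/By.
Qed.

End Action.

Section Diagonalisable.
Variables (K : fieldType) (V : lmodType K).

Lemma basis_free (I : choiceType) (b : I -> V) (S : {fset I}) (c : I -> K) :
  is_basis b -> \sum_(i <- S) c i *: b i = 0 -> forall i, i \in S -> c i = 0.
Proof.
move=> bb E i iS; have [c0 [_ uniq]] := bb 0.
pose c1 : {fsfun I -> K with 0} := [fsfun i in S => c i].
pose c2 : {fsfun I -> K with 0} := [fsfun].
have -> : c i = c1 i by rewrite fsfunE iS.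
rewrite -(uniq c1) ?(uniq c2) ?fsfun0E //; first by rewrite finsupp0 big_nil.
rewrite -[LHS]E; apply/esym; rewrite (big_fset_incl _ (finsupp_sub _ _ _)) /=.
  rewrite [LHS]big_seq [RHS]big_seq; apply: eq_bigr => j jS.
  by rewrite fsfunE jS.
by move=> j _; rewrite memNfinsupp => /eqP ->; rewrite scale0r.
Qed.

(** A diagonalisable operator has no Jordan block of size 2. *)
Lemma diagonalisable_square (f : V -> V) (c : K) (u : V) : linear f ->
  diagonalisable f -> f (f u - c *: u) = c *: (f u - c *: u) -> f u = c *: u.
Proof.
move=> fl [I [b [bb eig]]] sq.
pose a i : K := sval (cid (eig i)).
have fa i : f (b i) = a i *: b i := svalP (cid (eig i)).
have [co [Eu _]] := bb u.
have f0 : f 0 = 0 by have := fl (-1) 0 0; rewrite !scaleN1r oppr0 addr0 addNr.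
have fsum (C : I -> K) (S : {fset I}) :
    f (\sum_(i <- S) C i *: b i) = \sum_(i <- S) (a i * C i) *: b i.
  elim/big_rec2: _ => [//|i y1 y2 _ E]; rewrite fl E fa scalerA.
  by rewrite [C i * _]mulrC.
have fc (C : I -> K) S : \sum_(i <- S) (a i * C i) *: b i - c *: (\sum_(i <- S) C i *: b i)
    = \sum_(i <- S) ((a i - c) * C i) *: b i.
  rewrite scaler_sumr -sumrB; apply: eq_bigr => i _.
  by rewrite scalerA -scalerBl mulrBl.
have Ew : f u - c *: u = \sum_(i <- finsupp co) ((a i - c) * co i) *: b i.
  by rewrite {1 2}Eu fsum fc.
have /(basis_free bb) H : \sum_(i <- finsupp co) ((a i - c) * ((a i - c) * co i)) *: b i = 0.
  by rewrite -fc -fsum -Ew sq subrr.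
apply/eqP; rewrite -subr_eq0 Ew big_seq big1 // => i /H /eqP.
rewrite mulf_eq0 => /orP[/eqP ->|/eqP ->]; last by rewrite scale0r.
by rewrite mul0r scale0r.
Qed.

End Diagonalisable.

(** * Weight vectors of a pair of consecutive indices *)

Lemma forall_mem5 (T : eqType) (a b c d e : T) (P : T -> Prop) :
  (forall h, h \in [:: a; b; c; d; e] -> P h) <-> [/\ P a, P b, P c, P d & P e].
Proof.
split=> [H|[Pa Pb Pc Pd Pe] h]; last first.
  by rewrite !inE => /or4P[/eqP->|/eqP->|/eqP->|/orP[/eqP->|/eqP->]].
by split; apply: H; rewrite !inE eqxx ?orbT.
Qed.

Section Weights.
Variables (K : fieldType) (q : K) (d n : nat).
Hypothesis q0 : q != 0.
Hypothesis d0 : d%:R != 0 :> K.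
Local Notation Y := (yokonuma_hecke q d n).
Local Notation t := (@yh_t K q d n).
Local Notation g := (@yh_g K q d n).
Local Notation J := (jm q d n).
Local Notation kappa := (q - q^-1).
Implicit Types (i j : 'I_n.-1) (L : 'M[K]_(2, n)).

Section Rep.
Variables (V : lmodType K) (rho : representation V Y).

Definition is_weight L (v : V) : Prop :=
  forall k : 'I_n, rho (t k) v = L 0 k *: v /\ rho (J k) v = L 1 k *: v.

Lemma weight_order L v k : is_weight L v -> v != 0 -> L 0 k ^+ d = 1.
Proof.
move=> wv v0; have [tk _] := wv k.
have := act_exp d tk; rewrite t_order act1 => /esym/eqP.
rewrite -subr_eq0 -{2}[v]scale1r -scalerBl scaler_eq0 (negPf v0) orbF subr_eq0.
by move/eqP.
Qed.

Lemma act_e i a b (u : V) : a ^+ d = 1 -> b ^+ d = 1 ->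
    rho (t (ord_lo i)) u = a *: u -> rho (t (ord_hi i)) u = b *: u ->
  rho (yh_e d t i) u = (a == b)%:R *: u.
Proof.
move=> ad bd ta tb; rewrite actZl act_suml -(root_unity_sum d0 ad bd) -scalerA.
congr (_ *: _); rewrite scaler_suml; apply: eq_bigr => s _.
by rewrite actM (act_exp _ tb) actZr (act_exp _ ta) scalerA mulrC.
Qed.

Lemma act_gg i u : rho (g i) (rho (g i) u) = u + kappa *: rho (yh_e d t i) (rho (g i) u).
Proof. by rewrite -actM g_quad actDl act1 actZl actM. Qed.

Lemma act_g_inj i u : rho (g i) u = 0 -> u = 0.
Proof. by move=> E; have := act_gg i u; rewrite E !act0r scaler0 addr0. Qed.

(** The g_i are invertible, and J_(i+1) = g_i J_i g_i. *)
Lemma act_J_inj (k : 'I_n) u : rho (J k) u = 0 -> u = 0.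
Proof.
case: k => k /=; elim: k u => [|k IH] u kn; first by rewrite act1.
have [j Ek] : {j : 'I_n.-1 | k = j :> nat}.
  by have kn' : (k < n.-1)%N by [clear -kn; lia]; exists (Ordinal kn').
subst k; rewrite jmS !actM => /act_g_inj /IH H; apply: (act_g_inj (i := j)).
by apply: H; exact: ltnW.
Qed.

Lemma weight_J_neq0 L v k : is_weight L v -> v != 0 -> L 1 k != 0.
Proof.
move=> wv; apply: contraNneq => E; apply/eqP/(act_J_inj (k := k)).
by have [_ ->] := wv k; rewrite E scale0r.
Qed.

Lemma weight_J1 L v (k : 'I_n) : k = 0 :> nat -> is_weight L v -> v != 0 -> L 1 k = 1.
Proof.
move=> k0 wv v0; have [_ /esym/eqP] := wv k; rewrite k0 /= act1.
rewrite -subr_eq0 -{2}[v]scale1r -scalerBl scaler_eq0 (negPf v0) orbF subr_eq0.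
by move/eqP.
Qed.

Section Pair.
Variables (L : 'M[K]_(2, n)) (v : V) (i : 'I_n.-1).
Hypothesis wv : is_weight L v.
Hypothesis v0 : v != 0.
Let lo := ord_lo i.
Let hi := ord_hi i.
Local Notation a := (L 0 lo).
Local Notation b := (L 0 hi).
Local Notation x := (L 1 lo).
Local Notation y := (L 1 hi).
Let eps : K := (a == b)%:R.

Lemma act_t_g k : rho (t k) (rho (g i) v) = L 0 (tperm lo hi k) *: rho (g i) v.
Proof. by rewrite -actM t_g actM (wv _).1 actZr. Qed.

Lemma act_ggv : rho (g i) (rho (g i) v) = v + (kappa * eps) *: rho (g i) v.
Proof.
rewrite act_gg (act_e (a := b) (b := a)) ?(weight_order _ wv) //.
- by rewrite scalerA /eps eq_sym.
- by rewrite act_t_g tpermL.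
- by rewrite act_t_g tpermR.
Qed.

(** Rests on J_i g_i = g_i^-1 J_(i+1) and g_i^-1 = g_i - (q - q^-1) e_i. *)
Lemma act_Jlo_g : rho (J lo) (rho (g i) v) = y *: rho (g i) v - (kappa * eps * y) *: v.
Proof.
set u := rho (J lo) _.
have Eu : rho (g i) u = y *: v.
  by rewrite /u -!actM ?mulrA -jmS (wv hi).2.
have := act_gg i u; rewrite Eu actZr.
rewrite actZr (act_e (a := a) (b := b)) ?(weight_order _ wv) ?(wv _).1 // => ->.
by rewrite !scalerA -/eps -mulrA [y * eps]mulrC mulrA addrK.
Qed.

Lemma act_Jhi_g : rho (J hi) (rho (g i) v) = x *: rho (g i) v + (kappa * eps * y) *: v.
Proof.
have -> : rho (J hi) (rho (g i) v) =
    rho (g i) (rho (J lo) (rho (g i) (rho (g i) v))).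
  by rewrite -!actM; congr (rho _ _); rewrite [J hi](jmS _ _ i) ?mulrA.
rewrite act_ggv !actDr !actZr; rewrite (wv lo).2 actZr; congr (_ + _).
by rewrite -actM -actM ?mulrA -jmS (wv hi).2 scalerA.
Qed.

Lemma act_Jfar_g (k : 'I_n) : k != lo -> k != hi ->
  rho (J k) (rho (g i) v) = L 1 k *: rho (g i) v.
Proof.
move=> kl kh; rewrite -actM.
have -> : J k * g i = g i * J k.
  have [ki|ik] := ltnP k i; first exact: jm_comm_lt.
  apply: jm_comm_gt => //; move: kl kh ik; rewrite -!val_eqE /=.
  by clear; lia.
by rewrite actM (wv k).2 actZr.
Qed.

(** The coefficient for which [twisted] below is an eigenvector of J_i. *)
Definition twist_coef : K := if a == b then kappa * y / (y - x) else 0.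
Definition twisted : V := rho (g i) v - twist_coef *: v.

Hypothesis xy : a = b -> x != y.

Lemma twist_coefE : twist_coef * (y - x) = kappa * eps * y.
Proof.
rewrite /twist_coef /eps; case: eqP => [E|_]; last by rewrite mulr0 !mul0r.
by rewrite mulr1 divfK // subr_eq0 eq_sym xy.
Qed.

Lemma twisted_weight : is_weight (xcol lo hi L) twisted.
Proof.
move=> k; rewrite !mxE; split.
  rewrite actBr actZr act_t_g (wv _).1 scalerBr; congr (_ - _).
  rewrite /twist_coef; case: eqP => [E|_]; last by rewrite !scale0r scaler0.
  rewrite !scalerA mulrC; congr (_ * _ *: _).
  by case: tpermP => [->|->|].
rewrite actBr actZr (wv k).2 /twisted.
have [->|kl] := eqVneq k lo.
  rewrite tpermL act_Jlo_g -twist_coefE scalerBr !scalerA -!addrA; congr (_ + _).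
  by rewrite -!scaleNr -scalerDl; congr (_ *: _); ring.
have [->|kh] := eqVneq k hi.
  rewrite tpermR act_Jhi_g -twist_coefE scalerBr !scalerA -!addrA; congr (_ + _).
  by rewrite -!scaleNr -scalerDl; congr (_ *: _); ring.
rewrite tpermD 1?eq_sym // act_Jfar_g // scalerBr !scalerA.
by rewrite [twist_coef * _]mulrC.
Qed.

(** If g_i v = a v, then the quadratic relation forces a = q or a = - q^-1, which
    means that the contents are adjacent. *)
Lemma twisted_neq0 : a = b -> q ^+ 2 * x != y -> q ^+ 2 * y != x -> twisted != 0.
Proof.
move=> ab xy1 xy2; apply/negP => /eqP; move/eqP; rewrite subr_eq0 => /eqP gv.
have := act_ggv; rewrite gv actZr gv scalerA /eps ab eqxx mulr1 scalerA.
rewrite -{2}[v]scale1r -scalerDl => /eqP; rewrite -subr_eq0 -scalerBl scaler_eq0.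
rewrite (negPf v0) orbF => /eqP E.
have : (twist_coef - q) * (twist_coef + q^-1) = 0 by rewrite -E; field.
have := twist_coefE; rewrite /eps ab eqxx mulr1 => H.
move/eqP; rewrite mulf_eq0 => /orP[|]; rewrite ?subr_eq0 ?addr_eq0 => /eqP Ea.
  case/negP: xy1; rewrite -subr_eq0; rewrite Ea in H.
  have -> : q ^+ 2 * x - y = - q * (q * (y - x) - kappa * y) by field.
  by rewrite H subrr mulr0.
case/negP: xy2; rewrite -subr_eq0; rewrite Ea in H.
have -> : q ^+ 2 * y - x = - q * (- q^-1 * (y - x) - kappa * y) by field.
by rewrite H subrr mulr0.
Qed.

Lemma twisted_neq0_colour : a != b -> twisted != 0.
Proof.
move=> ab; rewrite /twisted /twist_coef (negPf ab) scale0r subr0.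
by apply: contraNneq v0 => /act_g_inj ->.
Qed.

End Pair.

Section Admissible.
Hypothesis adm : jm_admissible rho.
Variables (L : 'M[K]_(2, n)) (v : V) (i : 'I_n.-1).
Hypothesis wv : is_weight L v.
Hypothesis v0 : v != 0.
Let lo := ord_lo i.
Let hi := ord_hi i.
Hypothesis kappa0 : kappa != 0.

(** If both eigenvalues were equal, J_(i+1) would act on v and g_i v by a Jordan
    block. *)
Lemma weight_neq : L 0 lo = L 0 hi -> L 1 lo != L 1 hi.
Proof.
move=> ab; apply/eqP => xy.
have [_ dg] := adm.1 hi.
have E := act_Jhi_g i wv v0; rewrite ab eqxx mulr1 in E.
have := @diagonalisable_square _ _ (rho (J hi)) (L 1 lo) (rho (g i) v) (act_linearr rho _) dg.
rewrite E -xy addrAC subrr add0r actZr (wv hi).2 -/hi -xy.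
rewrite scalerA scalerA mulrC => /(_ erefl) /eqP.
rewrite -subr_eq0 addrAC subrr add0r scaler_eq0 (negPf v0) orbF mulf_eq0.
by rewrite (negPf kappa0) (negPf (weight_J_neq0 _ wv v0)).
Qed.

(** If g_i v is not c v, then [twisted] spans a stable line.  Since this line and v
    have different eigenvalues for J_i, v lies in every stable complement of the
    line; hence so does [twisted], a contradiction. *)
Lemma weight_linked c : L 0 lo = L 0 hi -> c != 0 -> c - c^-1 = kappa ->
    c ^+ 2 != 1 -> L 1 hi = c ^+ 2 * L 1 lo -> rho (g i) v = c *: v.
Proof.
move=> ab c0 cE c1 yx.
have x0 : L 1 lo != 0 := weight_J_neq0 lo wv v0.
have xy := weight_neq.
(* Contents in ratio c^2 make the coefficient equal to c, the eigenvalue sought. *)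
have Ec : twist_coef L i = c.
  rewrite /twist_coef ab eqxx -/hi -/lo yx -cE.
  have c1' : c ^+ 2 - 1 != 0 by rewrite subr_eq0.
  by field; rewrite c0 /=; rewrite -{2}[L 1 lo]mul1r -mulrBl mulf_neq0.
apply/eqP; rewrite -subr_eq0 -Ec -/(twisted L v i); apply/negPn/negP => w0.
set w := twisted L v i in w0.
have wE : w = rho (g i) v - c *: v by rewrite /w /twisted Ec.
have ww := twisted_weight wv v0 xy; rewrite -/w in ww.
(* The line spanned by w, which is stable because w has the exchanged weight. *)
pose U : {pred V} := fun u => `[< exists r, u = r *: w >].
have wlo : rho (t lo) w = L 0 hi *: w by rewrite (ww _).1 mxE tpermL.
have whi : rho (t hi) w = L 0 lo *: w by rewrite (ww _).1 mxE tpermR.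
have wJlo : rho (J lo) w = L 1 hi *: w by rewrite (ww _).2 mxE tpermL.
have wJhi : rho (J hi) w = L 1 lo *: w by rewrite (ww _).2 mxE tpermR.
have wg : rho (g i) w = - c^-1 *: w.
  rewrite wE actBr actZr (act_ggv i wv v0) ab eqxx mulr1 -cE scalerBr !scalerA.
  rewrite mulNr mulVf // scaleN1r opprK scalerBl -addrA [RHS]addrC; congr (_ + _).
  by rewrite addrAC subrr add0r scaleNr.
clearbody w.
have subU : GRing.submod_closed U.
  split=> [|r u1 u2 /asboolP[s1 ->] /asboolP[s2 ->]]; apply/asboolP.
    by exists 0; rewrite scale0r.
  by exists (r * s1 + s2); rewrite scalerDl scalerA.
have stU : stable rho (subalg_gen [:: t lo; t hi; J lo; J lo.+1; g i]) U.
  apply: stable_subalg_gen => //; apply/forall_mem5.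
  split=> u /asboolP[s ->]; apply/asboolP; rewrite actZr.
  - by rewrite wlo scalerA; eexists.
  - by rewrite whi scalerA; eexists.
  - by rewrite wJlo scalerA; eexists.
  - by rewrite wJhi scalerA; eexists.
  - by rewrite wg scalerA; eexists.
have [W [subW stW [span disj]]] := adm.2 i U subU stU.
have /forall_mem5[_ _ WJlo _ Wg] h : h \in [:: t lo; t hi; J lo; J lo.+1; g i] ->
    {in W, forall u, rho h u \in W}.
  by move=> hin; apply: stW => B _; apply.
have [u /asboolP[al ->] [w' w'W vE]] := span v.
have [W0 WL] := subW.
have WD u1 u2 : u1 \in W -> u2 \in W -> u1 + u2 \in W.
  by move=> h1 h2; have := WL 1 _ _ h1 h2; rewrite scale1r.
have WZ r u1 : u1 \in W -> r *: u1 \in W by move=> h1; rewrite -[_ *: _]addr0; apply: WL.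
have wU r : r *: w \in U by apply/asboolP; exists r.
have al0 : al = 0.
  have E : (al * L 1 hi) *: w + rho (J lo) w' = (L 1 lo * al) *: w + L 1 lo *: w'.
    by have := (wv lo).2; rewrite vE actDr actZr wJlo scalerDr !scalerA.
  have E2 : rho (J lo) w' - L 1 lo *: w' = (al * (L 1 lo - L 1 hi)) *: w.
    apply/eqP; rewrite subr_eq -(inj_eq (addrI ((al * L 1 hi) *: w))) E.
    by rewrite addrA -scalerDl; apply/eqP; congr (_ *: _ + _); ring.
  have inW : (al * (L 1 lo - L 1 hi)) *: w \in W.
    rewrite -E2 -scaleN1r scalerA; apply: WD; last exact: WZ.
    exact: WJlo.
  have /eqP := disj _ (wU _) inW.
  rewrite scaler_eq0 (negPf w0) orbF mulf_eq0 subr_eq0 (negPf (xy ab)) orbF.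
  by move/eqP.
have vW : v \in W by rewrite vE al0 scale0r add0r.
have wW : w \in W.
  rewrite wE -scaleN1r scalerA; apply: WD; last exact: WZ.
  exact: Wg.
case/eqP: w0; apply: disj => //.
by rewrite -[w]scale1r.
Qed.
End Admissible.
End Rep.
End Weights.

(** * From the spectrum to content words *)

Lemma exprzN1 (K : fieldType) (x : K) : x ^ (-1) = x^-1.
Proof. by []. Qed.

Section QPowers.
Variables (K : fieldType) (q : K).
Hypothesis q_inf : forall m, (0 < m)%N -> q ^+ m != 1.
Hypothesis q0 : q != 0.
Local Notation kappa := (q - q^-1).

Lemma kappa_neq0 : kappa != 0.
Proof.
have := q_inf (isT : (0 < 2)%N); apply: contraNneq => /(congr1 ( *%R q)).
by rewrite mulrBr mulr0 divff // -expr2 => /eqP; rewrite subr_eq0.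
Qed.

Lemma q2_neqN1 : q ^+ 2 != -1.
Proof.
have := q_inf (isT : (0 < 4)%N); apply: contraNneq => E.
by rewrite (exprM q 2 2) E sqrrN expr1n.
Qed.

Lemma q2_expz_inj (z z' : int) : (q ^+ 2) ^ z = (q ^+ 2) ^ z' -> z = z'.
Proof.
have q20 : q ^+ 2 != 0 by rewrite expf_neq0.
move=> E; apply/eqP; rewrite -subr_eq0; apply/negPn/negP => nz.
have E1 : (q ^+ 2) ^ (z - z') = 1.
  by rewrite expfzDr // -invr_expz E divff // expfz_neq0.
have E2 : (q ^+ 2) ^ `|z - z'|%N = 1.
  have [->|->] : `|z - z'|%N = z - z' :> int \/ `|z - z'|%N = - (z - z') :> int by lia.
    by [].
  by rewrite -invr_expz E1 invr1.
have /q_inf/negP : (0 < 2 * `|z - z'|)%N by lia.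
by rewrite exprM; apply; apply/eqP.
Qed.

Variable d : nat.
Local Notation letter := ('I_d * int)%type.
Implicit Types x y : letter.

Definition content x : K := (q ^+ 2) ^ x.2.

Lemma content_neq0 x : content x != 0.
Proof. by rewrite expfz_neq0 // expf_neq0. Qed.

Lemma content_inj x y : x.1 = y.1 -> content x = content y -> x = y.
Proof.
move=> E1 /q2_expz_inj E2.
by rewrite [x]surjective_pairing [y]surjective_pairing E1 E2.
Qed.

Lemma content_shift x e : content (shift x e) = (q ^+ 2) ^ e * content x.
Proof. by rewrite /content /= expfzDr ?expf_neq0 // mulrC. Qed.

End QPowers.

Section SpectrumRules.
Variables (K : fieldType) (q : K) (d n : nat).
Hypothesis q_inf : forall m, (0 < m)%N -> q ^+ m != 1.
Hypothesis q0 : q != 0.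
Hypothesis d0 : d%:R != 0 :> K.
Local Notation Y := (yokonuma_hecke q d n).
Local Notation kappa := (q - q^-1).
Local Notation spec := (spec_jm q d n).
Implicit Types (i j : 'I_n.-1) (L : 'M[K]_(2, n)).

Lemma spec_order L k : spec L -> L 0 k ^+ d = 1.
Proof. by case=> [V [rho [v [_ v0 wv]]]]; apply: weight_order wv v0. Qed.

Lemma spec_first L (k : 'I_n) : k = 0 :> nat -> spec L -> L 1 k = 1.
Proof. by move=> k0 [V [rho [v [_ v0 wv]]]]; apply: weight_J1 k0 wv v0. Qed.

Lemma spec_neq L i : spec L -> L 0 (ord_lo i) = L 0 (ord_hi i) ->
  L 1 (ord_lo i) != L 1 (ord_hi i).
Proof.
by case=> [V [rho [v [adm v0 wv]]]]; apply: weight_neq wv v0 (kappa_neq0 q_inf q0).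
Qed.

Lemma spec_swap L i : spec L ->
    (L 0 (ord_lo i) = L 0 (ord_hi i) -> q ^+ 2 * L 1 (ord_lo i) != L 1 (ord_hi i)
       /\ q ^+ 2 * L 1 (ord_hi i) != L 1 (ord_lo i)) ->
  spec (xcol (ord_lo i) (ord_hi i) L).
Proof.
move=> sL unl; have xy := spec_neq (i := i) sL; case: sL => [V [rho [v [adm v0 wv]]]].
exists V, rho, (twisted rho L v i); split=> //; last exact: (twisted_weight d0 wv v0 xy).
have [ab|ab] := eqVneq (L 0 (ord_lo i)) (L 0 (ord_hi i)).
  by have [h1 h2] := unl ab; exact: (twisted_neq0 q0 d0 wv v0 xy ab h1 h2).
exact: twisted_neq0_colour.
Qed.

Lemma spec_linked_scalar c : c = q \/ c = - q^-1 ->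
  [/\ c != 0, c - c^-1 = kappa & c ^+ 2 != 1].
Proof.
have q2 := q_inf (isT : (0 < 2)%N).
case=> ->; split=> //; first by rewrite oppr_eq0 invr_eq0.
  by rewrite invrN invrK opprK addrC.
by rewrite sqrrN exprVn invr_eq1.
Qed.

(** By [weight_linked], g_i v = c v and g_(i+1) v = - c^-1 v, so that the braid
    relation reads - c = c^-1, against c^2 <> - 1. *)
Lemma spec_no_sandwich L i j c : j = i.+1 :> nat -> spec L -> c = q \/ c = - q^-1 ->
    L 0 (ord_lo i) = L 0 (ord_hi i) -> L 0 (ord_lo j) = L 0 (ord_hi j) ->
    L 1 (ord_hi i) = c ^+ 2 * L 1 (ord_lo i) ->
  L 1 (ord_hi j) <> c ^- 2 * L 1 (ord_lo j).
Proof.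
move=> ji [V [rho [v [adm v0 wv]]]] cq ab ab' y1 y2.
have [c0 cE c1] := spec_linked_scalar cq.
have gi := weight_linked d0 adm wv v0 (kappa_neq0 q_inf q0) ab c0 cE c1 y1.
have cq' : - c^-1 = q \/ - c^-1 = - q^-1.
  by case: cq => ->; [right|left; rewrite invrN invrK opprK].
have [c0' cE' c1'] := spec_linked_scalar cq'.
have gj : rho (yh_g q d j) v = - c^-1 *: v.
  have y2' E := weight_linked d0 adm wv v0 (kappa_neq0 q_inf q0) ab' c0' cE' c1' E.
  by apply: y2'; rewrite sqrrN exprVn.
have := congr1 (fun a => rho a v) (g_braid q d ji).
rewrite !actM gi gj !actZr gi gj !actZr gi gj !scalerA => /eqP.
rewrite -subr_eq0 -scalerBl scaler_eq0 (negPf v0) orbF subr_eq0.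
rewrite -subr_eq0 => /eqP E.
have : c ^+ 2 + 1 = - c * (c * - c^-1 * c - - c^-1 * c * - c^-1) by field.
rewrite E mulr0 => /eqP; rewrite addr_eq0.
case: cq => ->; rewrite ?sqrrN ?exprVn ?(negPf (q2_neqN1 q_inf)) //.
by rewrite -(inj_eq invr_inj) invrK invrN invr1 (negPf (q2_neqN1 q_inf)).
Qed.

End SpectrumRules.

Section SpectrumWords.
Variables (K : fieldType) (q zeta : K) (d n' : nat).
Hypothesis q_inf : forall m, (0 < m)%N -> q ^+ m != 1.
Hypothesis q0 : q != 0.
Hypothesis d0 : d%:R != 0 :> K.
Hypothesis zeta_prim : d.-primitive_root zeta.
Local Notation n := n'.+1.
Local Notation letter := ('I_d * int)%type.
Local Notation spec := (spec_jm q d n).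
Implicit Types (x y : letter) (w : nat -> letter) (L : 'M[K]_(2, n)).

Definition colour x : K := zeta ^+ x.1.
Definition encode w : 'M[K]_(2, n) :=
  \matrix_(r, k) if r == 0 then colour (w k) else content q (w k).

Lemma colour_inj x y : (colour x == colour y) = (x.1 == y.1).
Proof.
by rewrite (eq_prim_root_expr zeta_prim) !modn_small.
Qed.

Lemma encode_inj w w' m : (m < n)%N -> encode w = encode w' -> w m = w' m.
Proof.
move=> mn E; have /matrixP H := E; have := H 0 (Ordinal mn); have := H 1 (Ordinal mn).
rewrite !mxE /= => /(q2_expz_inj q_inf q0) E2 /eqP; rewrite colour_inj => /eqP E1.
by rewrite [w m]surjective_pairing [w' m]surjective_pairing E1 E2.
Qed.

Lemma encode0 w k : encode w 0 k = colour (w k). Proof. by rewrite mxE. Qed.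
Lemma encode1 w k : encode w 1 k = content q (w k). Proof. by rewrite mxE. Qed.

Lemma encode_swap w (i : 'I_n.-1) :
  encode (swap i w) = xcol (ord_lo i) (ord_hi i) (encode w).
Proof.
apply/matrixP => r k; rewrite !mxE; suff -> : swap i w k = w (tperm (ord_lo i) (ord_hi i) k) by [].
by case: tpermP => [->|->|/eqP k1 /eqP k2]; rewrite /= ?swapL ?swapR ?swapO.
Qed.

(** By induction on the position, exchanging with the previous letter where this is
    possible: a content that cannot be moved to the front is q^2 or q^-2 times the
    previous one, and the first content is 1. *)
Lemma spec_word L : spec L -> exists w, L = encode w.
Proof.
move=> sL.
have H m L' (mn : (m < n)%N) : spec L' -> exists z : int, L' 1 (Ordinal mn) = (q ^+ 2) ^ z.
  elim: m L' mn => [|m IH] L' mn sL'; first by exists 0; rewrite expr0z (spec_first _ sL').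
  have [i Em] : {i : 'I_n.-1 | m = i :> nat} by exists (Ordinal (mn : (m < n.-1)%N)).
  subst m; have loE : Ordinal (ltnW mn) = ord_lo i by apply: val_inj.
  have hiE : Ordinal mn = ord_hi i by apply: val_inj.
  have [z1 E1] := IH L' (ltnW mn) sL'.
  have [E|ne] := eqVneq (q ^+ 2 * L' 1 (ord_lo i)) (L' 1 (ord_hi i)).
    by exists (1 + z1); rewrite hiE -E -loE E1 expfzDr ?expf_neq0 // expr1z.
  have [E|ne2] := eqVneq (q ^+ 2 * L' 1 (ord_hi i)) (L' 1 (ord_lo i)).
    exists (- 1 + z1); rewrite hiE expfzDr ?expf_neq0 // -E1 loE -E.
    by rewrite exprzN1 mulKf ?expf_neq0.
  have [z2 E2] := IH _ (ltnW mn) (spec_swap q_inf q0 d0 sL' (fun _ => conj ne ne2)).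
  by exists z2; rewrite -E2 loE hiE mxE tpermL.
have C k : exists x : letter, L 0 k = colour x /\ L 1 k = content q x.
  have /eqP/(prim_rootP zeta_prim)[c Ec] : L 0 k ^+ d == 1 by rewrite (spec_order k sL).
  have [z Ez] := H k L (ltn_ord k) sL.
  by exists (c, z); split=> //; rewrite /content /= -Ez; congr (L _ _); apply: val_inj.
exists (fun m => sval (cid (C (inord m)))); apply/matrixP => r k; rewrite mxE inord_val.
case: (svalP (cid (C k))) => E0 E1.
case: eqP => [->//|r0]; rewrite -E1; congr (L _ _).
by apply/val_inj; case: r r0 => [[|[]]] //= ? []; apply: val_inj.
Qed.

Lemma spec_encode_content w : spec (encode w) -> content_word n w.
Proof.
pose X w := spec (encode w); rewrite -/(X w).
have H i w1 : (i.+1 < n)%N -> exists2 j : 'I_n.-1, i = j :> nat &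
   [/\ encode w1 0 (ord_lo j) = colour (w1 i), encode w1 1 (ord_lo j) = content q (w1 i),
   encode w1 0 (ord_hi j) = colour (w1 i.+1) & encode w1 1 (ord_hi j) = content q (w1 i.+1)].
  by move=> lin; exists (Ordinal (lin : (i < n.-1)%N)) => //; rewrite !encode0 !encode1.
apply: exchange_content => {w} [w Xw|w i Xw lin E|w i Xw lin nl|w i e Xw e1 lin E E1].
- have := spec_first (k := ord0) erefl Xw; rewrite encode1 => E.
  by apply: (q2_expz_inj q_inf q0); rewrite expr0z.
- have [j ij [c1 s1 c2 s2]] := H i w lin.
  have := @spec_neq _ _ _ _ q_inf q0 d0 _ j Xw.
  by rewrite c1 c2 s1 s2 E eqxx => /(_ erefl).
- have [j ij [c1 s1 c2 s2]] := H i w lin; rewrite /X ij encode_swap.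
  apply: spec_swap => //; rewrite c1 c2 s1 s2 => /eqP; rewrite colour_inj => /eqP cE.
  have sh e : `|e|%N = 1%N -> w i.+1 != shift (w i) e.
    by move=> e1; apply: contraNneq nl => ->; apply/linkedP; right; exists e.
  have sh' e : `|e|%N = 1%N -> (q ^+ 2) ^ e * content q (w i) != content q (w i.+1).
    move=> e1; apply: contra (sh e e1); rewrite -(content_shift q0) => /eqP/(q2_expz_inj q_inf q0) E.
    by rewrite [w i.+1]surjective_pairing -cE -E /shift.
  split; first by have := sh' 1 erefl; rewrite expr1z.
  apply: contra (sh' (-1) erefl) => /eqP <-.
  by rewrite exprzN1 mulKf ?expf_neq0.
- have [j ij [c1 s1 c2 s2]] := H i w (ltnW lin).
  have [j' ij' [c1' s1' c2' s2']] := H i.+1 w lin.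
  have e2 : e = 1 \/ e = -1 by lia.
  (* The eigenvalue of g_i on a letter followed by the letter shifted by e. *)
  pose c := if e == 1 then q else - q^-1.
  have cE : c ^+ 2 = (q ^+ 2) ^ e.
    by rewrite /c; case: e2 => ->; rewrite ?expr1z //= exprzN1 sqrrN exprVn.
  have cq : c = q \/ c = - q^-1 by rewrite /c; case: ifP; [left|right].
  have jj : j' = j.+1 :> nat by rewrite -ij.
  apply: (spec_no_sandwich q_inf q0 d0 jj Xw cq); rewrite ?c1 ?c2 ?c1' ?c2' ?s1 ?s2 ?s1' ?s2' ?E E1.
  - by [].
  - by [].
  - by rewrite (content_shift q0) cE.
  - by rewrite (content_shift q0) cE mulKf // expfz_neq0 // expf_neq0.
Qed.

End SpectrumWords.

(** * Representations from operators satisfying the relations *)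

Section Lift.
Variables (K : fieldType) (q : K) (d n : nat) (V : lmodType K).
Local Notation gen := ('I_n.-1 + 'I_n)%type.
Local Notation free := {malg K[{fmonom gen}]}.
Variables (G : 'I_n.-1 -> V -> V) (T : 'I_n -> V -> V).
Hypothesis G_linear : forall i, linear (G i).
Hypothesis T_linear : forall k, linear (T k).

Definition gen_op (s : gen) : V -> V := match s with inl i => G i | inr k => T k end.

Definition word_op (w : seq gen) (v : V) : V := foldr gen_op v w.

Definition free_act (x : free) (v : V) : V :=
  \sum_(k <- msupp x) x@_k *: word_op (k : {fmonom gen}) v.

Lemma gen_op_linear s : linear (gen_op s).
Proof. by case: s => [i|k]; [exact: G_linear|exact: T_linear]. Qed.

Lemma word_op_linear w : linear (word_op w).
Proof.
by elim: w => [|s w IH] c u v //=; rewrite IH gen_op_linear.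
Qed.

Lemma free_actE (D : {fset {fmonom gen}}) x v : (msupp x `<=` D)%fset ->
  free_act x v = \sum_(k <- D) x@_k *: word_op (k : {fmonom gen}) v.
Proof.
move=> xD; rewrite /free_act (big_fset_incl _ xD) // => k _ /mcoeff_outdom ->.
by rewrite scale0r.
Qed.

Lemma free_act_linearl v : linear (free_act^~ v).
Proof.
move=> c x y.
(* A common support, over which all three sums can be taken. *)
pose D := (msupp x `|` msupp y `|` msupp (c *: x + y))%fset.
have sx : (msupp x `<=` D)%fset by rewrite /D -fsetUA fsubsetUl.
have sy : (msupp y `<=` D)%fset by rewrite /D fsetUAC fsubsetUr.
have sxy : (msupp (c *: x + y) `<=` D)%fset by rewrite fsubsetUr.
rewrite (free_actE v sx) (free_actE v sy) (free_actE v sxy).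
rewrite scaler_sumr -big_split /=; apply: eq_bigr => k _.
by rewrite mcoeffD mcoeffZ scalerDl scalerA.
Qed.

Lemma free_act_linearr x : linear (free_act x).
Proof.
move=> c u v; rewrite /free_act scaler_sumr -big_split /=; apply: eq_bigr => k _.
by rewrite word_op_linear scalerDr !scalerA mulrC.
Qed.

Lemma free_actDl x y v : free_act (x + y) v = free_act x v + free_act y v.
Proof. by have := free_act_linearl v 1 x y; rewrite !scale1r. Qed.

Lemma free_act0l v : free_act 0 v = 0.
Proof. by rewrite /free_act msupp0 big_nil. Qed.

Lemma free_actZl c x v : free_act (c *: x) v = c *: free_act x v.
Proof. by have := free_act_linearl v c x 0; rewrite !addr0 free_act0l addr0. Qed.

Lemma free_actBl x y v : free_act (x - y) v = free_act x v - free_act y v.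
Proof. by rewrite free_actDl -[- y]scaleN1r free_actZl scaleN1r. Qed.

Lemma free_act_suml (I : Type) (r : seq I) (F : I -> free) v :
  free_act (\sum_(i <- r) F i) v = \sum_(i <- r) free_act (F i) v.
Proof. by elim/big_rec2: _ => [|i y1 y2 _ <-]; rewrite ?free_act0l ?free_actDl. Qed.

Lemma free_act0r x : free_act x 0 = 0.
Proof. by have := free_act_linearr x (-1) 0 0; rewrite !scaleN1r oppr0 addr0 addNr. Qed.

Lemma free_actDr x u v : free_act x (u + v) = free_act x u + free_act x v.
Proof. by have := free_act_linearr x 1 u v; rewrite !scale1r. Qed.

Lemma free_actZr x c v : free_act x (c *: v) = c *: free_act x v.
Proof. by have := free_act_linearr x c v 0; rewrite !addr0 free_act0r addr0. Qed.

Lemma free_act_sumr (I : Type) (r : seq I) (F : I -> V) x :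
  free_act x (\sum_(i <- r) F i) = \sum_(i <- r) free_act x (F i).
Proof. by elim/big_rec2: _ => [|i y1 y2 _ <-]; rewrite ?free_act0r ?free_actDr. Qed.

Lemma free_actU c (k : {fmonom gen}) v : free_act << c *g k >> v = c *: word_op k v.
Proof. by rewrite (free_actE v msuppU_le) big_seq_fset1 mcoeffUU. Qed.

Lemma free_act1 v : free_act 1 v = v.
Proof.
by rewrite -[1]/(mkmalgU (mone : {fmonom gen}) 1) free_actU scale1r fm1.
Qed.

Lemma free_actM x y v : free_act (x * y) v = free_act x (free_act y v).
Proof.
have E z u : free_act z u = \sum_(k <- msupp z) z@_k *: word_op (k : {fmonom gen}) u by [].
rewrite {1}(monalgE x) mulr_suml free_act_suml [RHS]E; apply: eq_bigr => k _.
rewrite {1}(monalgE y) mulr_sumr free_act_suml -free_actU [free_act y v]E free_act_sumr.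
apply: eq_bigr => l _; rewrite malgM_def fgmulUU free_actZr !free_actU scalerA mulrC.
by rewrite /word_op fmM foldr_cat.
Qed.

Lemma free_act_gen s v : free_act (free_gen K s) v = gen_op s v.
Proof. by rewrite free_gen.unlock free_actU scale1r fmU. Qed.

Definition e_op i v : V :=
  d%:R^-1 *: \sum_(s < d) iter s (T (ord_lo i)) (iter (d - s) (T (ord_hi i)) v).

Hypothesis rel_far : forall (i j : 'I_n.-1) v, (i.+1 < j)%N -> G i (G j v) = G j (G i v).
Hypothesis rel_braid : forall (i j : 'I_n.-1) v, j = i.+1 :> nat ->
  G i (G j (G i v)) = G j (G i (G j v)).
Hypothesis rel_tt : forall k l v, T k (T l v) = T l (T k v).
Hypothesis rel_tg : forall i k v,
  T k (G i v) = G i (T (tperm (ord_lo i) (ord_hi i) k) v).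
Hypothesis rel_order : forall k v, iter d (T k) v = v.
Hypothesis rel_quad : forall i v, G i (G i v) = v + (q - q^-1) *: e_op i (G i v).

Section Relations.
Variables (A : lalgType K) (act : A -> V -> V) (ga : 'I_n.-1 -> A) (ta : 'I_n -> A).
Hypothesis actM : forall x y v, act (x * y) v = act x (act y v).
Hypothesis actD : forall x y v, act (x + y) v = act x v + act y v.
Hypothesis actZ : forall c x v, act (c *: x) v = c *: act x v.
Hypothesis act1 : forall v, act 1 v = v.
Hypothesis act0 : forall v, act 0 v = 0.
Hypothesis act_g : forall i v, act (ga i) v = G i v.
Hypothesis act_t : forall k v, act (ta k) v = T k v.

(** The relations involve the algebra only through its action, so any algebra can
    stand for the free one here. *)
Lemma rel_act l r v : yh_rel q d ga ta l r -> act l v = act r v.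
Proof.
have tX k m u : act (ta k ^+ m) u = iter m (T k) u.
  by elim: m => [|m IH]; rewrite ?expr0 ?act1 // exprS actM IH act_t.
case=> {l r} [i j ij|i j ij|i j|i j|j|i].
- rewrite !actM !act_g; case/orP: ij => ij; first exact: rel_far.
  exact/esym/rel_far.
- by rewrite !actM !act_g; exact: rel_braid.
- by rewrite !actM !act_t; exact: rel_tt.
- by rewrite !actM !act_g !act_t; exact: rel_tg.
- by rewrite tX act1; exact: rel_order.
rewrite expr2 actM actD act1 actZ actM !act_g rel_quad; congr (_ + _ *: _).
rewrite /yh_e actZ /e_op; congr (_ *: _).
transitivity (\sum_(s < d) act (ta (ord_lo i) ^+ s * ta (ord_hi i) ^+ (d - s)) (G i v)).
  by apply: eq_bigr => s _; rewrite actM !tX.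
by elim/big_rec2: _ => [|s y1 y2 _ ->]; rewrite ?act0 ?actD.
Qed.

End Relations.

Lemma free_act_rel l r v : yh_rel q d (@free_g K n) (@free_t K n) l r ->
  free_act l v = free_act r v.
Proof.
apply: rel_act.
- exact: free_actM.
- exact: free_actDl.
- exact: free_actZl.
- exact: free_act1.
- exact: free_act0l.
- by move=> i u; exact: free_act_gen.
- by move=> i u; exact: free_act_gen.
Qed.

Local Notation Y := (yokonuma_hecke q d n).

Lemma free_act_ideal x v : yh_ideal q d x -> free_act x v = 0.
Proof.
move=> Ix; apply: (Ix [set y | forall u, free_act y u = 0]%classic).
  split=> [u|y z Hy Hz u|a y b Hy u]; first exact: free_act0l.
    by rewrite free_actDl Hy Hz addr0.
  by rewrite !free_actM Hy free_act0r.
by move=> l r lr u; rewrite free_actBl (free_act_rel u lr) subrr.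
Qed.

Lemma free_act_pi x v : free_act (yh_repr (yh_pi q d x)) v = free_act x v.
Proof.
apply/eqP; rewrite -subr_eq0 -free_actBl free_act_ideal //.
exact: yh_piK.
Qed.

Definition lift_act (a : Y) (v : V) : V := free_act (yh_repr a) v.

Lemma lift_act_linearl v : linear (lift_act^~ v).
Proof.
move=> c a b; rewrite /lift_act -{1}(yh_reprK a) -{1}(yh_reprK b) -yh_piZ -yh_piD.
by rewrite free_act_pi free_act_linearl.
Qed.

Lemma lift_act1 v : lift_act 1 v = v.
Proof. by rewrite /lift_act -[1]/(yh_pi q d 1) free_act_pi free_act1. Qed.

Lemma lift_actM a b v : lift_act (a * b) v = lift_act a (lift_act b v).
Proof.
rewrite /lift_act -{1}(yh_reprK a) -{1}(yh_reprK b) -yh_piM.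
by rewrite free_act_pi free_actM.
Qed.

(** The universal property of the presented algebra, for endomorphisms of a module:
    operators that satisfy the relations kill the ideal of relations. *)
Definition lift_rep : representation V Y :=
  @Representation K V Y lift_act lift_act_linearl
    (fun a => free_act_linearr (yh_repr a)) lift_act1 lift_actM.

Lemma lift_rep_g i v : lift_rep (yh_g q d i) v = G i v.
Proof. by rewrite /= /lift_act free_act_pi free_act_gen. Qed.

Lemma lift_rep_t k v : lift_rep (yh_t q d k) v = T k v.
Proof. by rewrite /= /lift_act free_act_pi free_act_gen. Qed.

End Lift.

(** * The seminormal coefficients *)

Section Coefficients.
Variables (K : fieldType) (q : K) (d : nat).
Hypothesis q_inf : forall m, (0 < m)%N -> q ^+ m != 1.
Hypothesis q0 : q != 0.
Local Notation letter := ('I_d * int)%type.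
Local Notation kappa := (q - q^-1).
Local Notation con := (content q).
Implicit Types x y z : letter.

Definition samecol x y : K := (x.1 == y.1)%:R.
Definition coef x y : K := samecol x y * (kappa * con y / (con y - con x)).

(** The quadratic relation forces this value on the product of the two off-diagonal
    coefficients attached to the letters [x], [y] and to [y], [x]. *)
Definition prodphi x y : K := 1 + kappa * samecol x y * coef x y - coef x y ^+ 2.

(** Only the product [phi x y * phi y x] matters for the relations.  This
    factorisation vanishes in both orders as soon as the product does, so that
    exchanges between letters with adjacent contents are cut off on both sides. *)
Definition phi x y : K :=
  if prodphi x y == 0 then 0 else if (x.2 < y.2)%R then prodphi x y else 1.

Lemma content_sub_neq0 x y : x.1 = y.1 -> x != y -> con y - con x != 0.
Proof.
by move=> E ne; rewrite subr_eq0; apply: contraNneq ne => /esym/(content_inj q_inf q0 E) ->.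
Qed.

Lemma samecolC x y : samecol x y = samecol y x.
Proof. by rewrite /samecol eq_sym. Qed.

Lemma coef_add x y : x != y -> coef x y + coef y x = kappa * samecol x y.
Proof.
move=> ne; rewrite /coef (samecolC y) /samecol; case: eqVneq => [E|_].
  have h := content_sub_neq0 E ne.
  have h' : con x - con y != 0 by rewrite -opprB oppr_eq0.
  by field; rewrite h h' q0.
by rewrite !mul0r mulr0 addr0.
Qed.

Lemma coef_content x y : x != y -> coef x y * con x + coef y x * con y = 0.
Proof.
move=> ne; rewrite /coef (samecolC y) /samecol; case: eqVneq => [E|_].
  have h := content_sub_neq0 E ne.
  have h' : con x - con y != 0 by rewrite -opprB oppr_eq0.
  by field; rewrite h h' q0.
by rewrite !mul0r addr0.
Qed.

Lemma prodphiC x y : prodphi x y = prodphi y x.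
Proof.
have [->//|ne] := eqVneq x y; have := coef_add ne.
rewrite /prodphi (samecolC y) => <-.
by ring.
Qed.

Lemma phiM x y : phi x y * phi y x = prodphi x y.
Proof.
rewrite /phi (prodphiC y); case: eqVneq => [->|nz]; first by rewrite mulr0.
case: (ltgtP x.2 y.2) => [_|_|E]; rewrite ?mulr1 ?mul1r //.
rewrite /prodphi /coef; suff -> : con y - con x = 0 by rewrite invr0 !mulr0 expr0n addr0 subr0.
by rewrite /content E subrr.
Qed.

Lemma phi_neq0 x y : (phi x y != 0) = (prodphi x y != 0).
Proof.
rewrite /phi; case: (eqVneq (prodphi x y) 0) => [_|nz] /=; first by rewrite eqxx.
by case: ifP => _; rewrite ?nz ?oner_eq0.
Qed.

(** For adjacent contents [coef x y] is q or - q^-1, a root of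
    1 + (q - q^-1) a - a^2. *)
Lemma prodphi_linked x y : x != y -> linked x y -> prodphi x y = 0.
Proof.
move=> ne /linkedP[E|[e e1 E]]; first by rewrite E eqxx in ne.
have E1 : x.1 = y.1 by rewrite E.
have h := content_sub_neq0 E1 ne.
have c0 := content_neq0 q0 x.
have sc : samecol x y = 1 by rewrite /samecol E1 eqxx.
rewrite /prodphi /coef sc mul1r mulr1.
move: h; rewrite E content_shift //.
have [->|->] : e = 1 \/ e = -1 by lia.
  rewrite expr1z => h; have q2 : q ^+ 2 - 1 != 0.
    by apply: contraNneq h => E2; rewrite -{2}[con x]mul1r -mulrBl E2 mul0r.
  field; rewrite q0 /=; rewrite -{2}[con x]mul1r -mulrBl mulf_neq0 //.
rewrite exprzN1 => h; have q2 : (q ^+ 2)^-1 - 1 != 0.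
  by apply: contraNneq h => E2; rewrite -{2}[con x]mul1r -mulrBl E2 mul0r.
have q2' : 1 - q ^+ 2 != 0.
  apply: contraNneq q2 => E2; rewrite -(mulKf (_ : q ^+ 2 != 0) ((q ^+ 2)^-1 - 1)) ?expf_neq0 //.
  by rewrite mulrBr divff ?expf_neq0 // mulr1 E2 mulr0.
field; rewrite q0 /= (_ : _ + _ = con x * (1 - q ^+ 2)) ?mulf_neq0 //; ring.
Qed.

Lemma phi_unlinked x y : x != y -> phi x y != 0 -> ~~ linked x y.
Proof.
by rewrite phi_neq0 => ne; apply: contra => lk; rewrite (prodphi_linked ne lk).
Qed.

(** This identity and the next two are the coefficients, in the braid relation, of
    the three arguments at which both sides do not agree term by term. *)
Lemma coef_braid1 x y z : x != y -> y != z -> x != z ->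
  coef x y * coef y z + coef x z * coef y x = coef y z * coef x z.
Proof.
move=> xy yz xz; rewrite /coef /samecol [y.1 == x.1]eq_sym.
case: (eqVneq x.1 y.1) => [E1|n1].
  rewrite E1; case: eqVneq => [E2|_]; last by rewrite !(mul0r, mulr0, addr0).
  have h1 := content_sub_neq0 E1 xy; have h2 := content_sub_neq0 E2 yz; have h3 := content_sub_neq0 (etrans E1 E2) xz.
  have h1' : con x - con y != 0 by rewrite -opprB oppr_eq0.
  by field; rewrite h1 h2 h3 h1' q0.
rewrite !(mul0r, mulr0, addr0); case: (eqVneq y.1 z.1) => [<-|_]; last by rewrite !mul0r.
by rewrite (negPf n1) !(mul0r, mulr0).
Qed.

Lemma coef_braid2 x y z : x != y -> y != z -> x != z ->
  coef x y * coef x z = coef y z * coef x y + coef x z * coef z y.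
Proof.
move=> xy yz xz; rewrite /coef /samecol [z.1 == y.1]eq_sym.
case: (eqVneq y.1 z.1) => [E1|n1].
  rewrite -E1; case: eqVneq => [E2|_]; last by rewrite !(mul0r, mulr0, addr0).
  have h1 := content_sub_neq0 E2 xy; have h2 := content_sub_neq0 E1 yz; have h3 := content_sub_neq0 (etrans E2 E1) xz.
  have h2' : con y - con z != 0 by rewrite -opprB oppr_eq0.
  by field; rewrite h1 h2 h3 h2' q0.
rewrite !(mul0r, mulr0, addr0); case: (eqVneq x.1 y.1) => [->|_]; last by rewrite !mul0r.
by rewrite (negPf n1) !(mul0r, mulr0).
Qed.

Lemma coef_braid3 x y z : x != y -> y != z -> x != z ->
  coef x y ^+ 2 * coef y z + prodphi x y * coef x z =
  coef y z ^+ 2 * coef x y + prodphi y z * coef x z.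
Proof.
move=> xy yz xz; rewrite /prodphi /coef /samecol.
case: (eqVneq x.1 y.1) => [E1|n1]; case: (eqVneq y.1 z.1) => [E2|n2].
- have h1 := content_sub_neq0 E1 xy; have h2 := content_sub_neq0 E2 yz; have h3 := content_sub_neq0 (etrans E1 E2) xz.
  rewrite (etrans E1 E2) eqxx; field; by rewrite h1 h2 h3 q0.
- by rewrite E1 (negPf n2) /= !(expr0n, mul0r, mulr0, addr0).
- by rewrite -E2 (negPf n1) /= !(expr0n, mul0r, mulr0, addr0).
by rewrite !(expr0n, mul0r, mulr0, addr0).
Qed.

End Coefficients.

(** * The seminormal representation *)

Section Transpositions.
Variable n : nat.
Implicit Types i j : 'I_n.-1.

Definition adj_tperm i : {perm 'I_n} := tperm (ord_lo i) (ord_hi i).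

Lemma adj_tperm2 i : (adj_tperm i * adj_tperm i = 1)%g.
Proof. exact: tperm2. Qed.

Lemma adj_tperm_far i j : (i.+1 < j)%N -> (adj_tperm i * adj_tperm j = adj_tperm j * adj_tperm i)%g.
Proof.
move=> ij; have : (adj_tperm i ^ adj_tperm j = adj_tperm i)%g.
  rewrite /adj_tperm tpermJ !tpermD // -val_eqE /=; lia.
by move/conjg_fixP/commgP.
Qed.

Lemma adj_tperm_braid i j : j = i.+1 :> nat ->
  (adj_tperm i * adj_tperm j * adj_tperm i = adj_tperm j * adj_tperm i * adj_tperm j)%g.
Proof.
move=> ij; have hl : ord_hi i = ord_lo j by apply: val_inj; rewrite /= ij.
have E : (adj_tperm j ^ adj_tperm i = adj_tperm i ^ adj_tperm j)%g.
  rewrite /adj_tperm !tpermJ -hl tpermR tpermD; first last.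
  - by rewrite -val_eqE /=; lia.
  - by rewrite -val_eqE /=; lia.
  by rewrite [tperm (ord_hi i) _ (ord_hi i)]tpermL tpermD // -val_eqE /= ?ij; lia.
move: E; rewrite /conjg !tpermV !mulgA.
by [].
Qed.

End Transpositions.

Section Seminormal.
Variables (K : fieldType) (q zeta : K) (d n' : nat).
Hypothesis q_inf : forall m, (0 < m)%N -> q ^+ m != 1.
Hypothesis q0 : q != 0.
Hypothesis d0 : d%:R != 0 :> K.
Hypothesis zeta_prim : d.-primitive_root zeta.
Local Notation n := n'.+1.
Local Notation letter := ('I_d * int)%type.
Local Notation kappa := (q - q^-1).
Variable w : nat -> letter.
Implicit Types (i j : 'I_n.-1) (p : {perm 'I_n}) (F : {perm 'I_n} -> K).

Definition pword p : nat -> letter := fun k => w (p (inord k)).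

(** Rearrangements are indexed by permutations, so that a word with repeated letters
    occurs several times and its weight is repeated accordingly. *)
Definition valid p : bool := content_word n (pword p).

(** Composition with [adj_tperm i] on this side permutes positions, not values. *)
Lemma pword_swap i p k : (k < n)%N -> pword (adj_tperm i * p)%g k = swap i (pword p) k.
Proof.
move=> kn; rewrite /pword permM.
have lo : ord_lo i = inord i by apply: val_inj; rewrite /= inordK // ltnS ltnW.
have hi : ord_hi i = inord i.+1 by apply: val_inj; rewrite /= inordK // ltnS.
have [->|ki] := eqVneq k (i : nat); first by rewrite swapL -lo tpermL hi.
have [->|ki'] := eqVneq k i.+1; first by rewrite swapR -hi tpermR lo.
rewrite swapO // tpermD // -val_eqE /= inordK // eq_sym //.
Qed.

Lemma valid_neq p i : valid p -> pword p i != pword p i.+1.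
Proof. by apply: content_neq; rewrite ltnS. Qed.

Lemma valid_swap p i : valid p -> phi q (pword p i) (pword p i.+1) != 0 ->
  valid (adj_tperm i * p)%g.
Proof.
move=> vp ph; rewrite /valid (eq_content_word (w' := swap i (pword p))).
  apply: content_swap => //; first by rewrite ltnS.
  exact: (phi_unlinked q_inf q0 (valid_neq i vp) ph).
by move=> k; exact: pword_swap.
Qed.

(** The seminormal formula for g_i, on functions on all permutations.  The relations
    hold at the valid ones, where the coefficients are well defined. *)
Definition pair_fun i F p : K := coef q (pword p i) (pword p i.+1) * F p
  + phi q (pword p i) (pword p i.+1) * F (adj_tperm i * p)%g.

Lemma pair_fun_far i j F p : (i.+1 < j)%N -> pair_fun i (pair_fun j F) p = pair_fun j (pair_fun i F) p.
Proof.
move=> ij; have jn : (j.+1 < n)%N by rewrite ltnS.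
have in_ : (i.+1 < n)%N by lia.
rewrite /pair_fun !pword_swap; try lia.
rewrite !swapO; try lia.
by rewrite !mulgA (adj_tperm_far ij); ring.
Qed.

(** Three consecutive letters of a content word are pairwise distinct, which keeps
    all denominators away from zero. *)
Lemma pair_fun_braid i j F p : j = i.+1 :> nat -> valid p ->
  pair_fun i (pair_fun j (pair_fun i F)) p = pair_fun j (pair_fun i (pair_fun j F)) p.
Proof.
move=> ij vp; have jn : (i.+2 < n)%N by rewrite -ij ltnS.
have xy := valid_neq i vp; have yz := valid_neq j vp; have xz := content_neq_next jn vp.
rewrite ij in yz.
have ti0 p' : pword (adj_tperm i * p')%g i = pword p' i.+1 by rewrite pword_swap ?swapL //; lia.
have ti1 p' : pword (adj_tperm i * p')%g i.+1 = pword p' i by rewrite pword_swap ?swapR //; lia.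
have ti2 p' : pword (adj_tperm i * p')%g i.+2 = pword p' i.+2 by rewrite pword_swap ?swapO //; lia.
have tj0 p' : pword (adj_tperm j * p')%g i = pword p' i by rewrite pword_swap ?swapO //; lia.
have tj1 p' : pword (adj_tperm j * p')%g i.+1 = pword p' i.+2 by rewrite pword_swap -?ij ?swapL //; lia.
have tj2 p' : pword (adj_tperm j * p')%g i.+2 = pword p' i.+1 by rewrite pword_swap -?ij ?swapR //; lia.
rewrite /pair_fun ij !(ti0, ti1, ti2, tj0, tj1, tj2).
set x := pword p i in xy xz *; set y := pword p i.+1 in xy yz *.
set z := pword p i.+2 in yz xz *.
have E1 := coef_braid1 q_inf q0 xy yz xz; have E2 := coef_braid2 q_inf q0 xy yz xz.
have := coef_braid3 q_inf q0 xy yz xz; rewrite -!(phiM q_inf q0) => E3.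
have iK : (adj_tperm i * (adj_tperm i * p) = p)%g by rewrite mulgA adj_tperm2 mul1g.
have jK : (adj_tperm j * (adj_tperm j * p) = p)%g by rewrite mulgA adj_tperm2 mul1g.
have ijK : (adj_tperm i * (adj_tperm j * (adj_tperm i * p)) = adj_tperm j * (adj_tperm i * (adj_tperm j * p)))%g.
  by rewrite !mulgA adj_tperm_braid.
rewrite iK jK ijK; apply/eqP; rewrite -subr_eq0; apply/eqP.
move: E1 E2 E3; set a := coef q x y; set b := coef q y z; set c := coef q x z.
set a' := coef q y x; set b' := coef q z y; move=> E1 E2 E3.
(* Collect the terms according to the argument of F; the others cancel. *)
transitivity (F p * (a ^+ 2 * b + phi q x y * phi q y x * c
                      - (b ^+ 2 * a + phi q y z * phi q z y * c))
   + phi q x y * F (adj_tperm i * p)%g * (a * b + c * a' - b * c)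
   + phi q y z * F (adj_tperm j * p)%g * (a * c - (b * a + c * b'))); first by ring.
by rewrite E1 E2 E3 !subrr !mulr0 !addr0.
Qed.

Lemma samecol_colour (x y : letter) : samecol K x y = (colour zeta x == colour zeta y)%:R.
Proof. by rewrite /samecol (colour_inj zeta_prim). Qed.

Lemma pair_fun_quad i F p : valid p ->
  pair_fun i (pair_fun i F) p = F p + kappa * (samecol K (pword p i) (pword p i.+1) * pair_fun i F p).
Proof.
move=> vp; have in_ := ltn_ord i; have xy := valid_neq i vp; rewrite /pair_fun mulgA adj_tperm2 mul1g.
rewrite !pword_swap ?swapL ?swapR; try lia.
have := coef_add q_inf q0 xy; have := phiM q_inf q0 (pword p i) (pword p i.+1).
rewrite /prodphi.
move: (pword p i) (pword p i.+1) => x y.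
set a := coef q x y; set a' := coef q y x; set e := samecol _ _ _ => E1 E2.
apply/eqP; rewrite -subr_eq0; apply/eqP.
transitivity (F p * (phi q x y * phi q y x - (1 + kappa * e * a - a ^+ 2))
  + phi q x y * F (adj_tperm i * p)%g * (a + a' - kappa * e)); first by ring.
by rewrite E1 E2 !subrr !mulr0 addr0.
Qed.

Lemma pair_fun_content i F p : valid p ->
  pair_fun i (fun p' => content q (pword p' i) * pair_fun i F p') p = content q (pword p i.+1) * F p.
Proof.
move=> vp; have in_ := ltn_ord i; have xy := valid_neq i vp; rewrite /pair_fun mulgA adj_tperm2 mul1g.
rewrite !pword_swap ?swapL ?swapR; try lia.
have := coef_add q_inf q0 xy; have := phiM q_inf q0 (pword p i) (pword p i.+1).
rewrite /prodphi.
have := coef_content q_inf q0 xy.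
move: (pword p i) (pword p i.+1) => x y.
set a := coef q x y; set a' := coef q y x; set e := samecol _ _ _ => E3 E1 E2.
apply/eqP; rewrite -subr_eq0; apply/eqP.
transitivity (F p * (content q y * (phi q x y * phi q y x - (1 + kappa * e * a - a ^+ 2))
    + a * (a * content q x + a' * content q y) - a * content q y * (a + a' - kappa * e))
  + phi q x y * F (adj_tperm i * p)%g * (a * content q x + a' * content q y)); first by ring.
by rewrite E1 E2 E3 !subrr !mulr0 !addr0 subrr mulr0.
Qed.

Definition eq_valid F F' := forall p, valid p -> F p = F' p.

(** [phi] vanishes when [adj_tperm i] leads out of the valid permutations, so the
    functions that vanish on valid permutations form a stable subspace; the
    seminormal representation is the quotient by it. *)
Lemma pair_fun_eq_valid i F F' : eq_valid F F' -> eq_valid (pair_fun i F) (pair_fun i F').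
Proof.
move=> E p vp; rewrite /pair_fun E //; congr (_ + _).
have [->|ph] := eqVneq (phi q (pword p i) (pword p i.+1)) 0; first by rewrite !mul0r.
by rewrite E // valid_swap.
Qed.

Definition word_orbit := {p : {perm 'I_n} | valid p}.
Local Notation V := {ffun word_orbit -> K^o}.
Implicit Types (f : V) (u : word_orbit).

Definition extend0 f p : K := if insub p is Some u then f u else 0.

Lemma extend0_sval f u : extend0 f (sval u) = f u.
Proof. by rewrite /extend0 (valK (u : {p | valid p})). Qed.

Lemma extend0_valid f p (vp : valid p) : extend0 f p = f (Sub p vp).
Proof. by rewrite -extend0_sval /=. Qed.

Lemma extend0_inj f f' : eq_valid (extend0 f) (extend0 f') -> f = f'.
Proof. by move=> E; apply/ffunP => u; rewrite -!extend0_sval; apply: E; apply: valP. Qed.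

Definition g_op i f : V := [ffun u => pair_fun i (extend0 f) (sval u)].
Definition t_op (k : 'I_n) f : V := [ffun u => colour zeta (pword (sval u) k) * f u].

Lemma extend0_g_op i f : eq_valid (extend0 (g_op i f)) (pair_fun i (extend0 f)).
Proof. by move=> p vp; rewrite extend0_valid ffunE. Qed.

Lemma extend0_t_op k f : eq_valid (extend0 (t_op k f)) (fun p => colour zeta (pword p k) * extend0 f p).
Proof. by move=> p vp; rewrite !extend0_valid ffunE. Qed.

Lemma extend0_linear c f f' p : extend0 (c *: f + f') p = c * extend0 f p + extend0 f' p.
Proof. by rewrite /extend0; case: insub => [u|]; rewrite ?ffunE // mulr0 addr0. Qed.

Lemma g_op_linear i : linear (g_op i).
Proof.
move=> c f f'; apply/ffunP => u; rewrite !ffunE /pair_fun !extend0_linear.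
by rewrite -[c *: _]/(c * _); ring.
Qed.

Lemma t_op_linear k : linear (t_op k).
Proof.
by move=> c f f'; apply/ffunP => u; rewrite !ffunE -![_ *: _]/(_ * _); ring.
Qed.

Lemma g_op_far i j f : (i.+1 < j)%N -> g_op i (g_op j f) = g_op j (g_op i f).
Proof.
move=> ij; apply: extend0_inj => p vp.
rewrite !extend0_g_op // (pair_fun_eq_valid _ (extend0_g_op _ _)) // (pair_fun_eq_valid _ (extend0_g_op i f)) //.
exact: pair_fun_far.
Qed.

Lemma g_op_braid i j f : j = i.+1 :> nat -> g_op i (g_op j (g_op i f)) = g_op j (g_op i (g_op j f)).
Proof.
move=> ij; apply: extend0_inj => p vp; rewrite !extend0_g_op //.
have E i1 i2 i3 : eq_valid (extend0 (g_op i2 (g_op i3 f))) (pair_fun i2 (pair_fun i3 (extend0 f))).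
  by move=> p' vp'; rewrite extend0_g_op // (pair_fun_eq_valid _ (extend0_g_op _ _)).
by rewrite !(pair_fun_eq_valid _ (E _ _ _)) //; exact: pair_fun_braid.
Qed.

Lemma t_op_comm k l f : t_op k (t_op l f) = t_op l (t_op k f).
Proof. by apply/ffunP => u; rewrite !ffunE; ring. Qed.

Lemma t_op_iter k m f u : iter m (t_op k) f u = colour zeta (pword (sval u) k) ^+ m * f u.
Proof.
elim: m => [|m IH]; first by rewrite expr0 mul1r.
by rewrite iterS [LHS]ffunE IH exprS mulrA.
Qed.

Lemma colour_order (x : letter) : colour zeta x ^+ d = 1.
Proof. by rewrite /colour exprAC (prim_expr_order zeta_prim) expr1n. Qed.

Lemma t_op_order k f : iter d (t_op k) f = f.
Proof. by apply/ffunP => u; rewrite t_op_iter colour_order mul1r. Qed.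

Lemma pword_tperm i p (k : 'I_n) :
  pword (adj_tperm i * p)%g k = pword p (tperm (ord_lo i) (ord_hi i) k).
Proof. by rewrite /pword permM !inord_val. Qed.

Lemma t_op_g_op i k f : t_op k (g_op i f) = g_op i (t_op (tperm (ord_lo i) (ord_hi i) k) f).
Proof.
apply: extend0_inj => p vp; rewrite extend0_t_op // !extend0_g_op //.
rewrite (pair_fun_eq_valid _ (extend0_t_op _ _)) // /pair_fun !pword_tperm tpermK mulrDr; congr (_ + _); last first.
  by rewrite mulrCA.
rewrite /coef /samecol; case: eqP => [E|_]; last by rewrite !mul0r mulr0.
rewrite mulrCA; congr (_ * (_ * _)); rewrite /colour.
by case: tpermP => [->|->|//] /=; rewrite E.
Qed.

Lemma g_op_quad i f : g_op i (g_op i f) = f + kappa *: e_op d t_op i (g_op i f).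
Proof.
apply: extend0_inj => p vp; rewrite extend0_g_op // (pair_fun_eq_valid _ (extend0_g_op _ _)) // pair_fun_quad //.
rewrite [RHS]extend0_valid !ffunE -![_ *: _]/(_ * _) -extend0_valid; congr (_ + _ * _).
rewrite sum_ffunE samecol_colour.
under eq_bigr do rewrite !t_op_iter mulrA.
rewrite -mulr_suml mulrA root_unity_sum ?colour_order // -extend0_valid extend0_g_op //=.
Qed.

Definition seminormal_rep : representation V (yokonuma_hecke q d n) :=
  lift_rep g_op_linear t_op_linear g_op_far g_op_braid t_op_comm t_op_g_op t_op_order g_op_quad.

Lemma seminormal_t k f u :
  seminormal_rep (yh_t q d k) f u = colour zeta (pword (sval u) k) * f u.
Proof. by rewrite lift_rep_t ffunE. Qed.

Lemma seminormal_J k f u : (k < n)%N ->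
  seminormal_rep (jm q d n k) f u = content q (pword (sval u) k) * f u.
Proof.
elim: k f u => [|k IH] f u kn.
  rewrite act1; have /content_wordP/(_ 0%N isT)/addableP := svalP u.
  move=> H; have := H 1 erefl; have := H (-1) erefl; rewrite !cnt0 => h1 h2.
  have z0 : (pword (sval u) 0).2 = 0 by lia.
  by rewrite /content z0 expr0z mul1r.
pose i : 'I_n.-1 := Ordinal (kn : (k < n.-1)%N).
rewrite (jmS q d i : jm q d n k.+1 = _) !actM !lift_rep_g ffunE.
have kn' : (k < n)%N := ltnW kn.
have E : eq_valid (extend0 (seminormal_rep (jm q d n i) (g_op i f)))
   (fun p' => content q (pword p' i) * pair_fun i (extend0 f) p').
  by move=> p vp; rewrite extend0_valid IH // -extend0_valid extend0_g_op.
by rewrite (pair_fun_eq_valid _ E (svalP u)) pair_fun_content ?extend0_sval //; exact: (svalP u).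
Qed.

Hypothesis w_content : content_word n w.

Lemma valid1 : valid 1%g.
Proof.
rewrite /valid (eq_content_word (w' := w)) // => k kn.
by rewrite /pword perm1 inordK.
Qed.

End Seminormal.

(** * Complete reducibility *)

Section Semisimple.
Variables (K : fieldType) (V : lmodType K) (A : algType K) (rho : representation V A).
Variable B : set A.
Implicit Types U W X : {pred V}.

Definition submodule U : Prop := GRing.submod_closed U /\ stable rho B U.

Definition sum_pred U W : {pred V} :=
  fun v => `[< exists2 u, u \in U & exists2 w, w \in W & v = u + w >].

Lemma submodule0 U : submodule U -> 0 \in U. Proof. by case=> -[]. Qed.

Lemma submoduleZ U c v : submodule U -> v \in U -> c *: v \in U.
Proof. by case=> -[U0 UL] _ Uv; rewrite -[_ *: _]addr0; apply: UL. Qed.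

Lemma submoduleD U u v : submodule U -> u \in U -> v \in U -> u + v \in U.
Proof. by case=> -[U0 UL] _ Uu Uv; have := UL 1 u v Uu Uv; rewrite scale1r. Qed.

Lemma submoduleB U u v : submodule U -> u \in U -> v \in U -> u - v \in U.
Proof. by move=> sU Uu Uv; rewrite -scaleN1r; apply: submoduleD => //; apply: submoduleZ. Qed.

Lemma submodule_sum U W : submodule U -> submodule W -> submodule (sum_pred U W).
Proof.
move=> sU sW; split; first split.
- by apply/asboolP; exists 0; rewrite ?submodule0 //; exists 0; rewrite ?submodule0 ?addr0.
- move=> c x y /asboolP[u1 h1 [w1 k1 ->]] /asboolP[u2 h2 [w2 k2 ->]]; apply/asboolP.
  exists (c *: u1 + u2); first by apply: submoduleD => //; apply: submoduleZ.
  exists (c *: w1 + w2); first by apply: submoduleD => //; apply: submoduleZ.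
  by rewrite scalerDr addrACA.
- move=> a Ba v /asboolP[u hu [w hw ->]]; apply/asboolP.
  exists (rho a u); first by case: sU => _; apply.
  by exists (rho a w); [case: sW => _; apply|rewrite actDr].
Qed.

Lemma sum_predl U W v : submodule W -> v \in U -> v \in sum_pred U W.
Proof. by move=> sW Uv; apply/asboolP; exists v => //; exists 0; rewrite ?submodule0 ?addr0. Qed.

Lemma sum_predr U W v : submodule U -> v \in W -> v \in sum_pred U W.
Proof. by move=> sU Wv; apply/asboolP; exists 0; rewrite ?submodule0 //; exists v; rewrite ?add0r. Qed.

(** A complement of U is built by adding the simple submodules one at a time: each
    of them either lies in the sum of U and the complement built so far, or meets
    it in 0 and can be added. *)
Lemma simple_sum_completely_reducible (I : eqType) (s : seq I) (S : I -> {pred V}) :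
  (forall i, submodule (S i)) ->
  (forall i X v, submodule X -> v \in S i -> v \in X -> v != 0 -> {subset S i <= X}) ->
  (forall X, submodule X -> (forall i, i \in s -> {subset S i <= X}) -> forall v, v \in X) ->
  completely_reducible rho B.
Proof.
move=> Ssub simple span U U1 U2; have sU : submodule U by split.
suff [W [sW UW H]] : exists W, [/\ submodule W, forall v, v \in U -> v \in W -> v = 0
    & forall i, i \in s -> {subset S i <= sum_pred U W}].
  case: (sW) => W1 W2; exists W; split=> //; split=> // v.
  by have /asboolP := span _ (submodule_sum sU sW) H v.
elim: s {span} => [|i s [W [sW UW IH]]].
  have s0 : submodule (fun v => v == 0).
    split; first split=> [|c x y /eqP-> /eqP->]; rewrite ?scaler0 ?addr0 -?topredE //=.
    by move=> a _ v /eqP ->; rewrite act0r -topredE /=.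
  by exists (fun v => v == 0); split=> // v _ /eqP.
have [[v [vS vUW v0]]|no] :=
    pselect (exists v, [/\ v \in S i, v \in sum_pred U W & v != 0]).
  exists W; split=> // k; rewrite inE => /predU1P[->|/IH//].
  exact: simple (submodule_sum sU sW) vS vUW v0.
exists (sum_pred W (S i)); split; first exact: submodule_sum.
  move=> v Uv /asboolP[u Wu [x Sx E]].
  have x0 : x = 0.
    apply/eqP/negPn/negP => xn0; apply: no; exists x; split=> //.
    have -> : x = v - u by rewrite E addrAC subrr add0r.
    by apply: submoduleB; [exact: submodule_sum|exact: sum_predl|exact: sum_predr].
  by apply: UW => //; rewrite E x0 addr0.
have mono : {subset sum_pred U W <= sum_pred U (sum_pred W (S i))}.
  move=> v /asboolP[u Uu [x Wx ->]]; apply/asboolP; exists u => //; exists x => //.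
  exact: sum_predl.
move=> k; rewrite inE => /predU1P[->|/IH ks] v vS; last exact/mono/ks.
by apply: sum_predr => //; apply: sum_predr.
Qed.

End Semisimple.

Section PairBlock.
Variables (K : fieldType) (q : K) (d n : nat).
Hypothesis d0 : d%:R != 0 :> K.
Local Notation Y := (yokonuma_hecke q d n).
Local Notation t := (@yh_t K q d n).
Local Notation g := (@yh_g K q d n).
Local Notation J := (jm q d n).
Local Notation kappa := (q - q^-1).
Variables (V : lmodType K) (rho : representation V Y).
Variables (L : 'M[K]_(2, n)) (v : V) (i : 'I_n.-1).
Hypothesis wv : is_weight rho L v.
Hypothesis v0 : v != 0.
Let lo := ord_lo i.
Let hi := ord_hi i.
Let B := subalg_gen [:: t lo; t hi; J lo; J lo.+1; g i].

(** The span of a weight vector v and g_i v, a submodule for the subalgebra generated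
    by t_i, t_(i+1), J_i, J_(i+1) and g_i. *)
Definition pair_block : {pred V} := fun x => `[< exists c e, x = c *: v + e *: rho (g i) v >].

Lemma pair_block_submodule : submodule rho B pair_block.
Proof.
have sub : GRing.submod_closed pair_block.
  split=> [|c x y /asboolP[c1 [e1 ->]] /asboolP[c2 [e2 ->]]]; apply/asboolP.
    by exists 0, 0; rewrite !scale0r addr0.
  exists (c * c1 + c2), (c * e1 + e2).
  by rewrite !scalerDl scalerDr !scalerA addrACA.
split=> //; apply: stable_subalg_gen => //; apply/forall_mem5.
split=> x /asboolP[c [e ->]]; apply/asboolP; rewrite actDr !actZr.
- rewrite (wv _).1 (act_t_g i wv) !scalerA; do 2 eexists; reflexivity.
- rewrite (wv _).1 (act_t_g i wv) !scalerA; do 2 eexists; reflexivity.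
- rewrite (wv _).2 (act_Jlo_g d0 i wv v0) scalerBr !scalerA addrCA addrC -scalerBl.
  by do 2 eexists; reflexivity.
- rewrite (wv hi).2 (act_Jhi_g d0 i wv v0) scalerDr !scalerA addrCA -scalerDl addrC.
  by do 2 eexists; reflexivity.
rewrite (act_ggv d0 i wv v0) scalerDr scalerA addrCA -scalerDl.
by do 2 eexists; reflexivity.
Qed.

Hypothesis xy : L 0 lo = L 0 hi -> L 1 lo != L 1 hi.
Let c0 := twist_coef q L i.
Let w := twisted rho L v i.
Hypothesis twisted_eq0_or : w = 0 \/
  1 + kappa * (L 0 lo == L 0 hi)%:R * c0 - c0 ^+ 2 != 0.

(** The vectors v and g_i v - a v have different weights, so a non-zero stable
    subspace contains one of them, and g_i leads from each to the other. *)
Lemma pair_block_simple (X : {pred V}) x : submodule rho B X ->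
  x \in pair_block -> x \in X -> x != 0 -> {subset pair_block <= X}.
Proof.
move=> sX /asboolP[c [e ->]]; case: (sX) => X1 X2.
have /forall_mem5[Xtlo _ XJlo _ Xg] h : h \in [:: t lo; t hi; J lo; J lo.+1; g i] ->
    {in X, forall u, rho h u \in X}.
  by move=> hin; apply: X2 => b _; apply.
suff vX : c *: v + e *: rho (g i) v \in X -> c *: v + e *: rho (g i) v != 0 -> v \in X.
  move=> h1 h2 y /asboolP[c1 [e1 ->]]; have {}vX := vX h1 h2.
  by apply: (submoduleD sX); apply: (submoduleZ _ sX) => //; apply: Xg.
have gE : rho (g i) v = w + c0 *: v by rewrite /w /twisted subrK.
have -> : c *: v + e *: rho (g i) v = (c + e * c0) *: v + e *: w.
  by rewrite gE scalerDr scalerA addrCA addrC -scalerDl.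
set a := c + e * c0 => vX vn0.
have divX r u : r != 0 -> r *: u \in X -> u \in X.
  by move=> rn0 /(submoduleZ r^-1 sX); rewrite scalerA mulVf // scale1r.
have [e0|en0] := eqVneq (e *: w) 0.
  by move: vX vn0; rewrite e0 addr0 scaler_eq0 negb_or => vX /andP[an0 _]; exact: divX an0 vX.
have [wn0 en0'] : w != 0 /\ e != 0 by move: en0; rewrite scaler_eq0 negb_or => /andP[].
have ww := twisted_weight d0 wv v0 xy; rewrite -/w in ww.
pose eps : K := (L 0 lo == L 0 hi)%:R.
have wg : (1 + kappa * eps * c0 - c0 ^+ 2) *: v = rho (g i) w - (kappa * eps - c0) *: w.
  rewrite {1}/w /twisted -/c0 actBr actZr (act_ggv d0 i wv v0) -/eps -[v + _ - _]addrA -scalerBl.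
  rewrite gE scalerDr scalerA addrCA [_ *: w + _]addrC addrK -{2}[v]scale1r -scalerDl.
  by congr (_ *: _); ring.
have dich : w = 0 \/ 1 + kappa * eps * c0 - c0 ^+ 2 != 0 := twisted_eq0_or.
clearbody w.
have wX : w \in X.
  have [ab|nab] := eqVneq (L 0 lo) (L 0 hi).
    have := submoduleB sX (XJlo _ vX) (submoduleZ (L 1 lo) sX vX).
    rewrite actDr !actZr (wv lo).2 (ww lo).2 mxE tpermL -/hi.
    rewrite scalerDr !scalerA [a * _]mulrC opprD addrACA subrr add0r -scalerBl.
    apply: divX; rewrite mulrC -mulrBl mulf_neq0 // subr_eq0 eq_sym.
    exact: xy.
  have := submoduleB sX (Xtlo _ vX) (submoduleZ (L 0 lo) sX vX).
  rewrite actDr !actZr (wv lo).1 (ww lo).1 mxE tpermL -/hi.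
  rewrite scalerDr !scalerA [a * _]mulrC opprD addrACA subrr add0r -scalerBl.
  by apply: divX; rewrite mulrC -mulrBl mulf_neq0 // subr_eq0 eq_sym.
have [E|Pn0] := dich; first by rewrite E eqxx in wn0.
apply: divX Pn0 _.
rewrite wg.
by apply: (submoduleB sX); [exact: Xg|exact: (submoduleZ _ sX)].
Qed.

End PairBlock.

(** * Admissibility of the seminormal representation *)

Section FinfunBasis.
Variables (K : fieldType) (Q : finType).
Local Notation V := {ffun Q -> K^o}.
Implicit Types (u : Q) (f : V).

Definition delta u : V := [ffun u' => (u' == u)%:R].

Lemma delta_sum f : f = \sum_u f u *: delta u.
Proof.
apply/ffunP => u; rewrite sum_ffunE (bigD1 u) //= !ffunE eqxx.
rewrite big1 ?addr0 => [|u' ne]; first by rewrite -[_ *: _]/(_ * _) mulr1.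
by rewrite !ffunE eq_sym (negPf ne) scaler0.
Qed.

Lemma delta_basis : is_basis (delta : Q -> V).
Proof.
have ev (c : {fsfun Q -> K with 0}) u : (\sum_(i <- finsupp c) c i *: delta i) u = c u.
  rewrite sum_ffunE; have [uc|nuc] := boolP (u \in finsupp c).
    rewrite (big_rem u) //= !ffunE eqxx big_seq big1 ?addr0.
      by rewrite -[_ *: _]/(_ * _) mulr1.
    move=> u'; rewrite mem_rem_uniq ?fset_uniq // inE => /andP[ne _].
    by rewrite !ffunE eq_sym (negPf ne) scaler0.
  rewrite big_seq big1 => [|u' u'c]; first by move: nuc; rewrite memNfinsupp => /eqP ->.
  rewrite !ffunE; case: eqP => [E|_]; last by rewrite scaler0.
  by rewrite E u'c in nuc.
move=> f; pose S : {fset Q} := [fset u in enum Q]%fset.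
pose c : {fsfun Q -> K with 0} := [fsfun u in S => f u].
have cE u : c u = f u by rewrite fsfunE /S !inE mem_enum.
exists c; split; first by apply/ffunP => u; rewrite ev cE.
by move=> c' E; apply/fsfunP => u; rewrite cE E ev.
Qed.

Lemma diagonal_diagonalisable (op : V -> V) (a : Q -> K) :
  (forall f u, op f u = a u * f u) -> diagonalisable op.
Proof.
move=> opE; exists Q, delta; split; first exact: delta_basis.
move=> u; exists (a u); apply/ffunP => u'; rewrite opE !ffunE.
by case: eqP => [->|_]; rewrite ?mulr0 ?scaler0.
Qed.

End FinfunBasis.

Section Admissible.
Variables (K : fieldType) (q zeta : K) (d n' : nat).
Hypothesis q_inf : forall m, (0 < m)%N -> q ^+ m != 1.
Hypothesis q0 : q != 0.
Hypothesis d0 : d%:R != 0 :> K.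
Hypothesis zeta_prim : d.-primitive_root zeta.
Local Notation n := n'.+1.
Local Notation letter := ('I_d * int)%type.
Local Notation kappa := (q - q^-1).
Variable w : nat -> letter.
Local Notation Q := (word_orbit n' w).
Local Notation rho := (seminormal_rep n' q_inf q0 d0 zeta_prim w).
Implicit Types (u : Q) (i : 'I_n.-1).

Lemma delta_weight u : is_weight rho (encode q zeta n' (pword w (sval u))) (delta K u).
Proof.
move=> k; split; apply/ffunP => u'.
  rewrite seminormal_t !ffunE encode0; case: eqP => [->//|_].
  by rewrite mulr0 scaler0.
rewrite seminormal_J ?ltn_ord // !ffunE encode1; case: eqP => [->//|_].
by rewrite mulr0 scaler0.
Qed.

Lemma delta_neq0 u : delta K u != 0.
Proof.
apply/eqP => /ffunP/(_ u); rewrite !ffunE eqxx => /eqP.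
by rewrite oner_eq0.
Qed.

Lemma delta_neq u i (L := encode q zeta n' (pword w (sval u))) :
  L 0 (ord_lo i) = L 0 (ord_hi i) -> L 1 (ord_lo i) != L 1 (ord_hi i).
Proof.
rewrite !encode0 !encode1 => /eqP; rewrite colour_inj // => /eqP E.
apply: contra (valid_neq i (svalP u)) => /eqP.
by move/(content_inj q_inf q0 E) ->.
Qed.

Lemma delta_twist_coef u i : twist_coef q (encode q zeta n' (pword w (sval u))) i =
  coef q (pword w (sval u) i) (pword w (sval u) i.+1).
Proof.
rewrite /twist_coef !encode0 !encode1 colour_inj // /coef /samecol.
by case: eqP => _; rewrite ?mul1r ?mul0r.
Qed.

(** For an indicator function, g_i v - a v is a multiple of another indicator
    function, and vanishes together with [phi]. *)
Lemma delta_twisted u i (L := encode q zeta n' (pword w (sval u))) :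
  twisted rho L (delta K u) i = 0 \/
  1 + kappa * (L 0 (ord_lo i) == L 0 (ord_hi i))%:R * twist_coef q L i - twist_coef q L i ^+ 2 != 0.
Proof.
rewrite delta_twist_coef !encode0 -samecol_colour // -/(prodphi q _ _).
have [E|] := eqVneq (prodphi q (pword w (sval u) i) (pword w (sval u) i.+1)) 0; last by right.
left; rewrite /twisted delta_twist_coef; apply/ffunP => u'.
rewrite !ffunE lift_rep_g ffunE /pair_fun extend0_sval.
have [->|ne] := eqVneq u' u.
  rewrite ffunE eqxx mulr1 -[_ *: _]/(_ * _) mulr1 addrAC subrr add0r.
  have [->|ph] := eqVneq (phi q (pword w (sval u) i) (pword w (sval u) i.+1)) 0.
    by rewrite mul0r.
  by rewrite phi_neq0 E eqxx in ph.
rewrite ffunE (negPf ne) mulr0 scaler0 subr0 add0r.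
have [->|ph] := eqVneq (phi q (pword w (sval u') i) (pword w (sval u') i.+1)) 0.
  by rewrite mul0r.
have v' := valid_swap q_inf q0 (svalP u') ph.
rewrite extend0_valid ffunE; case: eqP => [Eu|_]; last by rewrite mulr0.
move: E; rewrite -Eu /= !pword_swap ?swapL ?swapR; last 2 first.
- by have := ltn_ord i; rewrite /= => ?; lia.
- by have := ltn_ord i; rewrite /= => ?; lia.
rewrite prodphiC // => E.
by rewrite phi_neq0 E eqxx in ph.
Qed.

Hypothesis w_content : content_word n w.

Lemma seminormal_admissible : jm_admissible rho.
Proof.
split=> [k|i].
  split; first by apply: diagonal_diagonalisable => f u; exact: seminormal_t.
  by apply: diagonal_diagonalisable => f u; apply: seminormal_J.
pose S (u : Q) := pair_block rho (delta K u) i.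
apply: (simple_sum_completely_reducible (s := enum {: Q}) (S := S)).
- by move=> u; exact: (pair_block_submodule d0 i (delta_weight u) (delta_neq0 u)).
- move=> u X x sX xb xX x0.
  exact: (pair_block_simple d0 (delta_weight u) (delta_neq0 u) (delta_neq (u := u) (i := i))
    (delta_twisted u i) sX xb xX x0).
move=> X sX H f; rewrite (delta_sum f).
elim/big_rec: _ => [|u f' _ Xf']; first exact: (submodule0 sX).
apply: (submoduleD sX) => //; apply: (submoduleZ _ sX); apply: (H u); first by rewrite mem_enum.
by apply/asboolP; exists 1, 0; rewrite scale1r scale0r addr0.
Qed.

Lemma content_spec : spec_jm q d n (encode q zeta n' w).
Proof.
pose u : Q := Sub 1%g (valid1 w_content).
exists {ffun Q -> K^o}, rho, (delta K u); split.
- exact: seminormal_admissible.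
- exact: delta_neq0.
suff -> : encode q zeta n' w = encode q zeta n' (pword w (sval u)) by exact: delta_weight.
by apply/matrixP => r k; rewrite !mxE /pword perm1 inord_val.
Qed.

End Admissible.

(** * The bijection *)

Section Bijection.
Variables (K : fieldType) (q zeta : K) (d n' : nat).
Hypothesis q_inf : forall m, (0 < m)%N -> q ^+ m != 1.
Hypothesis q0 : q != 0.
Hypothesis d0 : d%:R != 0 :> K.
Hypothesis zeta_prim : d.-primitive_root zeta.

(** The bijection holds over any field with a primitive d-th root of unity in which
    q is neither zero nor a root of unity; C(q) is one. *)
Lemma tableau_spectrum_bij :
  set_bij (stab d n'.+1) (spec_jm q d n'.+1) (fun laT => encode q zeta n' (tableau_word laT.2)).
Proof.
split=> [[la T] S|[la T] [la' T']|L sL] /=.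
- exact: (content_spec q_inf q0 d0 zeta_prim (stab_content S)).
- rewrite !in_setE => S S' E; apply: stab_word_inj S S' _ => m mn.
  exact: (encode_inj q_inf q0 zeta_prim mn E).
have [w E] := spec_word q_inf q0 d0 zeta_prim sL.
have Ww : content_word n'.+1 w.
  by apply: (spec_encode_content q_inf q0 d0 zeta_prim); rewrite -E.
(* The word of this tableau is w, up to position n. *)
exists (word_shape n' w, word_tableau n' w); first exact: word_tableau_stab.
rewrite E; apply/matrixP => r k; rewrite !mxE /=.
by rewrite tableau_word_tableau.
Qed.

End Bijection.

(** X^m - 1 splits and is separable. *)
Lemma primitive_root_exists (C : numClosedFieldType) m : (0 < m)%N ->
  exists z : C, m.-primitive_root z.
Proof.
pose p : {poly C} := 'X^m - 1; have [r Dp] := closed_field_poly_normal p.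
move=> m_gt0; rewrite (monicP _) ?monicXnsubC // scale1r in Dp.
have rm1 : all m.-unity_root r by apply/allP => z; rewrite -root_prod_XsubC -Dp.
have sz_r : (m < (size r).+1)%N.
  by rewrite -(size_prod_XsubC r id) -Dp size_XnsubC.
have [|z] := hasP (has_prim_root m_gt0 rm1 _ sz_r); last by exists z.
by rewrite -separable_prod_XsubC -Dp separable_Xn_sub_1 // pnatr_eq0 -lt0n.
Qed.

Lemma Cq_inf (R : realType) m : (0 < m)%N -> Cq_q R ^+ m != 1.
Proof.
move=> m0; rewrite /Cq_q -tofracXn -tofrac1 tofrac_eq.
apply/eqP => /(congr1 (fun p : {poly R[i]} => size p)).
by rewrite size_polyXn size_poly1 => -[m00]; rewrite m00 in m0.
Qed.

Theorem proposition7 (R : realType) (d n : nat) (hd : (0 < d)%N) (hn : (0 < n)%N) :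
  exists f : {ffun 'I_d -> seq nat} * {ffun 'I_n -> dnode d} -> 'M[Cq R]_(2, n),
    set_bij (stab d n) (spec_jm (Cq_q R) d n) f.
Proof.
case: n hn => // n' _.
have [z z_prim] := primitive_root_exists R[i] hd.
have q0 : Cq_q R != 0 by rewrite tofrac_eq0 polyX_eq0.
have d0 : d%:R != 0 :> Cq R.
  by rewrite -tofrac1 -tofracMn tofrac_eq0 -polyC1 -polyCMn polyC_eq0 pnatr_eq0 -lt0n.
have zeta_prim : d.-primitive_root (tofrac z%:P : Cq R).
  by rewrite (fmorph_primitive_root (@tofrac _ \o polyC : {rmorphism R[i] -> Cq R})).
exists (fun laT => encode (Cq_q R) (tofrac z%:P) n' (tableau_word laT.2)).
exact: (tableau_spectrum_bij n' (@Cq_inf R) q0 d0 zeta_prim).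
Qed.
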